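(* Let $\bm{\hat u}^*=(\bm{\hat u}_1^*,\dots,\bm{\hat u}_{N_x}^* )$ be a fixed point of the classical IPM iteration, and assume that this iteration is contractive at $\bm{\hat u}^*$, i.e. the Jacobian at $\bm{\hat u}^*$ of the map $(\bm{\hat u}_j)_{j=1}^{N_x}\mapsto\big(\bm{\tilde c}(\bm{\hat u}_{j-1},\bm{\hat u}_j,\bm{\hat u}_{j+1})\big)_{j=1}^{N_x}$ has spectral radius strictly less than $1$. Let $\bm{\lambda}^*=(\bm{\lambda}^*_j)_{j=1}^{N_x}$ with $\bm{\lambda}_j^*=\bm{\hat\lambda}(\bm{\hat u}_j^* )$. Then the One-Shot IPM iteration converges locally: there exists $\delta>0$ such that for all starting points $(\bm\lambda^0,\bm{\hat u}^0)\in B_\delta(\bm\lambda^*,\bm{\hat u}^* )$ (the open ball of radius $\delta$ around $(\bm\lambda^*,\bm{\hat u}^* )$), the One-Shot IPM iterates $(\bm\lambda^n,\bm{\hat u}^n)$ satisfy $$\Vert(\bm\lambda^n,\bm{\hat u}^n)-(\bm\lambda^*,\bm{\hat u}^* )\Vert\to 0\qquad\text{for } n\to\infty .$$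
   Context: Setting (Intrusive Polynomial Moment (IPM) method for a steady hyperbolic problem, iterated in pseudo-time, one space dimension). Let $m,p,M,N_x,Q$ be natural numbers. Let $\bm f:\mathbb{R}^m\to\mathbb{R}^m$ be the physical flux and $\bm g:\mathbb{R}^m\times\mathbb{R}^m\to\mathbb{R}^m$ a consistent numerical flux ($\bm g(\bm u,\bm u)=\bm f(\bm u)$). Let $\bm\xi\in\Theta\subseteq\mathbb{R}^p$ be a random vector with density $f_\Xi$ (a product of one-dimensional densities), let $\varphi_i:\Theta\to\mathbb{R}$, $|i|\le M$ ($i=(i_1,\dots,i_p)$ a multi-index, $|i|=\sum_n i_n$), be polynomials orthonormal with respect to $f_\Xi$, and put $N=\binom{M+p}{p}$, $\bm\varphi=(\varphi_i)_{|i|\le M}\in\mathbb{R}^N$. Given quadrature weights $w_k$ and points $\bm\xi_k$, $k=1,\dots,Q$, write $\langle h\rangle_Q:=\sum_{k=1}^Q w_k h(\bm\xi_k)f_\Xi(\bm\xi_k)$. Let $s:\mathbb{R}^m\to\mathbb{R}$ be a strictly convex entropy, $s_*$ its Legendre transform and $\bm u_s:=(\nabla_{\bm u}s)^{-1}=\nabla s_*$. For a moment matrix $\bm{\hat u}=(\bm{\hat u}_i)_{|i|\le M}\in\mathbb{R}^{N\times m}$ and $\bm\lambda=(\bm\lambda_i)_{|i|\le M}\in\mathbb{R}^{N\times m}$ let $$L(\bm\lambda;\bm{\hat u}):=\langle s_*(\bm\lambda^T\bm\varphi)\rangle_Q-\sum_{|i|\le M}\bm\lambda_i^T\bm{\hat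 u}_i .$$ Its gradient is $\nabla_{\bm\lambda}L(\bm\lambda;\bm{\hat u})=\langle\bm u_s(\bm\lambda^T\bm\varphi)\bm\varphi^T\rangle_Q^T-\bm{\hat u}$, and its Hessian in $\bm\lambda$ (with $\mathbb{R}^{N\times m}$ identified with $\mathbb{R}^{N\cdot m}$) is denoted $\bm H(\bm\lambda)=\langle\nabla\bm u_s(\bm\lambda^T\bm\varphi)\otimes\bm\varphi\bm\varphi^T\rangle_Q^T$. The exact dual variables $\bm{\hat\lambda}(\bm{\hat u})$ are the unique minimizer of $L(\cdot\,;\bm{\hat u})$, so that $\langle\bm u_s(\bm{\hat\lambda}(\bm{\hat u})^T\bm\varphi)\bm\varphi^T\rangle_Q^T=\bm{\hat u}$. The dual (Newton) iteration function is $$\bm d(\bm\lambda,\bm{\hat u}):=\bm\lambda-\bm H(\bm\lambda)^{-1}\cdot\nabla_{\bm\lambda}L(\bm\lambda;\bm{\hat u}).$$ For $\Delta t,\Delta x>0$ define $$\bm c(\bm\lambda_\ell,\bm\lambda_c,\bm\lambda_r):=\langle\bm u_s(\bm\lambda_c^T\bm\varphi)\bm\varphi^T\rangle_Q^T-\frac{\Delta t}{\Delta x}\Big(\langle\bm g(\bm u_s(\bm\lambda_c^T\bm\varphi),\bm u_s(\bm\lambda_r^T\bm\varphi))\bm\varphi^T\rangle_Q^T-\langle\bm g(\bm u_s(\bm\lambda_\ell^T\bm\varphi),\bm u_s(\bm\lambda_c^T\bm\varphi))\bm\varphi^T\rangle_Q^T\Big)$$ and $\bm{\tilde c}(\bm{\hat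 u}_\ell,\bm{\hat u}_c,\bm{\hat u}_r):=\bm c(\bm{\hat\lambda}(\bm{\hat u}_\ell),\bm{\hat\lambda}(\bm{\hat u}_c),\bm{\hat\lambda}(\bm{\hat u}_r))$. Spatial cells are $j=1,\dots,N_x$; the boundary (ghost) cells $j=0$ and $j=N_x+1$ carry prescribed values $\bm{\hat u}_0,\bm{\hat u}_{N_x+1}$ and $\bm\lambda_0=\bm{\hat\lambda}(\bm{\hat u}_0)$, $\bm\lambda_{N_x+1}=\bm{\hat\lambda}(\bm{\hat u}_{N_x+1})$ which do not change during the iterations. Classical IPM iteration: $\bm{\hat u}_j^{n+1}=\bm{\tilde c}(\bm{\hat u}_{j-1}^n,\bm{\hat u}_j^n,\bm{\hat u}_{j+1}^n)$ for $j=1,\dots,N_x$. One-Shot IPM iteration: for $j=1,\dots,N_x$, $\bm\lambda_j^{n+1}=\bm d(\bm\lambda_j^n,\bm{\hat u}_j^n)$, followed by $\bm{\hat u}_j^{n+1}=\bm c(\bm\lambda_{j-1}^{n+1},\bm\lambda_j^{n+1},\bm\lambda_{j+1}^{n+1})$ (with $\bm\lambda_0^{n+1}=\bm\lambda_0$ and $\bm\lambda_{N_x+1}^{n+1}=\bm\lambda_{N_x+1}$). Here $\bm\lambda^n=(\bm\lambda_j^n)_{j=1}^{N_x}$, $\bm{\hat u}^n=(\bm{\hat u}_j^n)_{j=1}^{N_x}$, and $(\bm\lambda^n,\bm{\hat u}^n)\in\mathbb{R}^{N\cdot m\cdot N_x}\times\mathbb{R}^{N\cdot m\cdot N_x}$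 with a norm $\Vert\cdot\Vert$ on this finite-dimensional space. Standing regularity: $\bm u_s$ and $\bm g$ are smooth enough that the derivatives involved exist and are continuous near the fixed point, $\bm H(\bm\lambda)$ is invertible, and $\bm{\hat\lambda}(\cdot)$ is well defined where used. *)

(* Defs.v *)
From HB Require Import structures.
From mathcomp Require Import all_boot all_order all_algebra.
From mathcomp Require Import all_classical all_reals all_analysis.
From mathcomp Require Import complex.
From mathcomp Require mpoly.

Set Implicit Arguments.
Unset Strict Implicit.
Unset Printing Implicit Defensive.

Import Order.TTheory GRing.Theory Num.Theory.
Import numFieldNormedType.Exports.

Local Open Scope classical_set_scope.
Local Open Scope ring_scope.

Section calculus.
Context {R : realType}.

Definition grad n k (F : 'M[R]_(n, k) -> R) (x : 'M[R]_(n, k)) : 'M[R]_(n, k) :=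
  \matrix_(i, j) 'D_(delta_mx i j) F x.

(* Row-vector convention: mxvec ('d F x h) = mxvec h *m jac F x. *)
Definition jac n k n' k' (F : 'M[R]_(n, k) -> 'M[R]_(n', k'))
    (x : 'M[R]_(n, k)) : 'M[R]_(n * k, n' * k') :=
  lin_mx ('d F x).

Definition C1_near (V W : normedModType R) (F : V -> W) (a : V) : Prop :=
  \forall x \near a, differentiable F x /\
    forall h, {for x, continuous (fun y => 'd F y h)}.

(* The sup of the empty set is 0, which is the value in dimension 0. *)
Definition spectral_radius n (A : 'M[R]_n) : R :=
  sup [set ComplexField.Normc.normc z |
       z in [set z | eigenvalue (map_mx (real_complex R) A) z]].

Definition is_norm (V : lmodType R) (nrm : V -> R) : Prop :=
  [/\ forall x y, nrm (x + y) <= nrm x + nrm y,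
      forall (a : R) x, nrm (a *: x) = `|a| * nrm x
    & forall x, nrm x = 0 -> x = 0].

Definition strictly_convex (V : lmodType R) (F : V -> R) : Prop :=
  forall (x y : V) (t : R), x != y -> 0 < t < 1 ->
    F (t *: x + (1 - t) *: y) < t * F x + (1 - t) * F y.

Definition legendre n (F : 'cV[R]_n -> R) (v : 'cV[R]_n) : R :=
  sup [set (v^T *m u) 0 0 - F u | u in [set: 'cV[R]_n]].

End calculus.

Section random_parameter.
Context {R : realType}.

(* Lebesgue integral over R^p of a nonnegative function, by Tonelli. *)
Fixpoint integral_Rn (p : nat) : (p.-tuple R -> \bar R) -> \bar R :=
  match p with
  | 0 => fun h => h [tuple]
  | q.+1 => fun h =>
      (\int[lebesgue_measure]_x integral_Rn (fun v => h [tuple of x :: v]))%E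
  end.

Definition is_density1 (f : R -> R) : Prop :=
  [/\ measurable_fun setT f, forall x, 0 <= f x
    & (\int[lebesgue_measure]_x (f x)%:E)%E = 1%E].

Definition has_density d (Omega : measurableType d) (P : probability Omega R)
    p (xi : {RV P >-> p.-tuple R}) (f : p.-tuple R -> R) : Prop :=
  forall B : set (p.-tuple R), measurable B ->
    P (xi @^-1` B) = integral_Rn (fun x => (\1_B x * f x)%:E).

End random_parameter.

Local Notation basis_dim M p := 'C(M + p, p).

Record ipm_data (R : realType) (m p M Q : nat) := IpmData {
  num_flux : 'cV[R]_m * 'cV[R]_m -> 'cV[R]_m ;
  entropy : 'cV[R]_m -> R ;
  density1 : 'I_p -> R -> R ;
  (* bmultinom p M.+1 is the type of multi-indices of total degree < M.+1;
     multi_index numbers the rows of the moment matrices. *)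
  multi_index : 'I_(basis_dim M p) -> mpoly.bmultinom p M.+1 ;
  basis_poly : mpoly.bmultinom p M.+1 -> mpoly.mpoly p R ;
  weight : 'I_Q -> R ;
  node : 'I_Q -> p.-tuple R ;
  dt : R ;
  dx : R }.

Section ipm.
Context {R : realType} {m p M Q : nat} (S : ipm_data R m p M Q).

Local Notation N := (basis_dim M p).
Local Notation moments := 'M[R]_(basis_dim M p, m).

Definition joint_density (x : p.-tuple R) : R :=
  \prod_(n < p) density1 S n (tnth x n).

Definition basis_fun i (x : p.-tuple R) : R :=
  mpoly.meval (tnth x) (basis_poly S i).

Definition orthonormal_basis d (Omega : measurableType d)
    (P : probability Omega R) (xi : {RV P >-> p.-tuple R}) : Prop :=
  forall i j : mpoly.bmultinom p M.+1,
    'E_P[fun w => (basis_fun i (xi w) * basis_fun j (xi w))%R]%E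
    = (`[< i = j >]%:R)%:E.

Definition basis_vec (x : p.-tuple R) : 'cV[R]_N :=
  \col_a basis_fun (multi_index S a) x.

Definition quad (V : lmodType R) (h : p.-tuple R -> V) : V :=
  \sum_(k < Q) (weight S k * joint_density (node S k)) *: h (node S k).

(* Inverse of the gradient of the entropy where that gradient is bijective. *)
Definition u_s (v : 'cV[R]_m) : 'cV[R]_m :=
  xget 0 [set u | grad (entropy S) u = v].

Definition dual_state (lam : moments) (x : p.-tuple R) : 'cV[R]_m :=
  lam^T *m basis_vec x.

Definition dual_fun (lam uhat : moments) : R :=
  quad (fun x => legendre (entropy S) (dual_state lam x) : R^o)
  - \sum_(i < N) ((row i lam) *m (row i uhat)^T) 0 0.

Definition dual_grad (lam uhat : moments) : moments :=
  grad (dual_fun^~ uhat) lam.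

(* Independent of uhat, because dual_fun is affine in uhat. *)
Definition dual_hess (lam uhat : moments) : 'M[R]_(N * m) :=
  jac (dual_grad^~ uhat) lam.

Definition unique_minimizer (uhat lam : moments) : Prop :=
  forall mu, mu != lam -> dual_fun lam uhat < dual_fun mu uhat.

Definition dual_var (uhat : moments) : moments :=
  xget 0 (unique_minimizer uhat).

Definition newton (lam uhat : moments) : moments :=
  lam - vec_mx (mxvec (dual_grad lam uhat) *m invmx (dual_hess lam uhat)).

Definition fv_update (ll lc lr : moments) : moments :=
  let us lam x := u_s (dual_state lam x) in
  (quad (fun x => us lc x *m (basis_vec x)^T))^T
  - (dt S / dx S) *:
    ((quad (fun x => num_flux S (us lc x, us lr x) *m (basis_vec x)^T))^T
     - (quad (fun x => num_flux S (us ll x, us lc x) *m (basis_vec x)^T))^T).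

Definition fv_update_moments (ul uc ur : moments) : moments :=
  fv_update (dual_var ul) (dual_var uc) (dual_var ur).

Section grid.
Context {Nx : nat}.

(* Row j : 'I_Nx is the flattening of the moment matrix of cell j.+1. *)
Local Notation grid := 'M[R]_(Nx, N * m).

Definition inner_cell (U : grid) (j : 'I_Nx) : moments :=
  vec_mx (row j U).

Definition of_cells (F : 'I_Nx -> moments) : grid :=
  \matrix_(j < Nx) mxvec (F j).

(* Cells 0, ..., Nx.+1, including the ghost cells 0 and Nx.+1. *)
Definition cell (ghost_l ghost_r : moments) (U : grid) (j : nat) : moments :=
  if j is i.+1 then
    if insub i is Some i' then inner_cell U i' else ghost_r
  else ghost_l.

Definition classical_step (ul ur : moments) (U : grid) : grid :=
  of_cells (fun j => fv_update_moments (cell ul ur U j)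
                       (cell ul ur U j.+1) (cell ul ur U j.+2)).

Definition oneshot_step (ul ur : moments) (X : grid * grid)
    : grid * grid :=
  let Lam := of_cells (fun j => newton (inner_cell X.1 j) (inner_cell X.2 j)) in
  let lam j := cell (dual_var ul) (dual_var ur) Lam j in
  (Lam, of_cells (fun j => fv_update (lam j) (lam j.+1) (lam j.+2))).

End grid.
End ipm.

(* Main.v *)
Require Import Defs.
From HB Require Import structures.
From mathcomp Require Import all_boot all_order all_algebra.
From mathcomp Require Import all_classical all_reals all_analysis.
From mathcomp Require Import complex ring lra.

(* At the fixed point the gradient of the dual function vanishes, so the derivative of the Newton map in [lam] is zero and its derivative in [uhat] is [H^-1], which is also the derivative of [dual_var]. Hence the classical step, which is the finite-volume update [C] after [dual_var], has derivative [DC \o H^-1], while the One-Shot step has the block derivative [(h, k) |-> (H^-1 k, DC (H^-1 k))]. The powers of the block operator are governed by those of [DC \o H^-1], so they tend to zero when its spectral radius is less than one, and Ostrowski's criterion gives local convergence.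

No inverse function theorem is needed: [dual_var] is a continuous right inverse of the C1 moment map near [ustar], and a continuous local inverse is differentiable wherever the derivative of the map is invertible. *)

Set Implicit Arguments.
Unset Strict Implicit.
Unset Printing Implicit Defensive.

Import Order.TTheory GRing.Theory Num.Theory.
Import numFieldNormedType.Exports.

Local Open Scope classical_set_scope.
Local Open Scope ring_scope.

(** * Differential calculus *)

Section differentiability.
Context {R : realType} {V W : normedModType R}.
Implicit Types (f : V -> W) (x : V).

(** The little-o expansion in epsilon form, the shape in which all remainder estimates below are
    carried out. *)
Lemma differentiable_small f x : differentiable f x ->
  forall e, 0 < e -> \forall y \near x,
    `|f y - f x - 'd f x (y - x)| <= e * `|y - x|.
Proof.
move=> /diff_locally fx e e0.
have /eqaddoP/(_ e e0) : f \o shift x = (cst (f x) + 'd f x) +o_ 0 id by exact: fx.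
rewrite !near_simpl => small.
rewrite (near_shift 0) subr0; apply: filterS small => h /=.
by rewrite addrK !fctE opprD addrA.
Qed.

(** Converse of the expansion above. Continuity of [L] is a separate hypothesis because [V] may be
    infinite-dimensional. *)
Lemma is_diff_small f x (L : {linear V -> W}) : continuous L ->
  (forall e, 0 < e -> \forall y \near x,
    `|f y - f x - L (y - x)| <= e * `|y - x|) ->
  is_diff x f L.
Proof.
move=> Lc small.
have fE : f \o shift x = cst (f x) + L +o_ 0 id.
  apply/eqaddoP => e e0; have := small e e0.
  rewrite (near_shift 0) subr0; apply: filterS => h /=.
  by rewrite addrK !fctE opprD addrA.
have dfE := diff_unique Lc fE.
split => //; apply/diff_locallyP; rewrite dfE; split=> //.
Qed.

(** Serves for the dual gradient and the Newton map, whose explicit formulas hold only near the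
    point of interest. *)
Lemma near_eq_is_diff f g x (df : V -> W) :
  {near x, f =1 g} -> is_diff x f df -> is_diff x g df.
Proof.
move=> fg [fx <-]; apply: is_diff_small => [|e e0]; first exact: diff_continuous.
have fgx : f x = g x := nbhs_singleton fg.
have := differentiable_small fx e0; rewrite -fgx.
by apply: filterS2 fg => y ->.
Qed.

End differentiability.

(** * Matrix spaces: linear maps, entrywise limits and derivatives, matrix inversion *)

Section matrix_space.
Context {R : realType}.

Lemma coord_le_norm m n (A : 'M[R]_(m, n)) i j : `|A i j| <= `|A|.
Proof.
rewrite [leRHS]/Num.Def.normr/= mx_normrE.
exact: (le_bigmax _ (fun ij : 'I_m * 'I_n => `|A ij.1 ij.2|) (i, j)).
Qed.

Lemma norm_le_coord m n (A : 'M[R]_(m, n)) e :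
  0 <= e -> (forall i j, `|A i j| <= e) -> `|A| <= e.
Proof.
move=> e0 Ae; rewrite [leLHS]/Num.Def.normr/= mx_normrE; apply: bigmax_le => //.
Qed.

Lemma linear_mxE m n (W : lmodType R) (f : {linear 'M[R]_(m, n) -> W}) A :
  f A = \sum_i \sum_j A i j *: f (delta_mx i j).
Proof.
rewrite {1}(matrix_sum_delta A) linear_sum; apply: eq_bigr => i _.
by rewrite linear_sum; apply: eq_bigr => j _; rewrite linearZ.
Qed.

Lemma mx_linear_le m n (W : normedModType R) (f : {linear 'M[R]_(m, n) -> W}) A :
  `|f A| <= (\sum_i \sum_j `|f (delta_mx i j)|) * `|A|.
Proof.
rewrite linear_mxE mulr_suml (le_trans (ler_norm_sum _ _ _))// ler_sum// => i _.
rewrite mulr_suml (le_trans (ler_norm_sum _ _ _))// ler_sum// => j _.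
by rewrite normrZ mulrC ler_wpM2l// coord_le_norm.
Qed.

Lemma mx_linear_continuous m n (W : normedModType R)
  (f : {linear 'M[R]_(m, n) -> W}) : continuous f.
Proof.
apply/linear_bounded_continuous/linear_boundedP.
near=> r => A; apply: le_trans (mx_linear_le f A) _.
apply: ler_wpM2r => //; near: r; apply: nbhs_pinfty_ge.
Unshelve. all: by end_near. Qed.

Lemma mx_linear_is_diff m n (W : normedModType R)
  (f : {linear 'M[R]_(m, n) -> W}) A : is_diff A f f.
Proof.
have fc := @mx_linear_continuous _ _ _ f.
split; [exact: linear_differentiable|exact: diff_lin].
Qed.

(** A linear map on the product is the sum of its restrictions to the two factors, and each of these
    is bounded by its values on the matrix units. *)
Lemma mx_pair_linear_continuous m n m' n' (W : normedModType R)
  (f : {linear ('M[R]_(m, n) * 'M[R]_(m', n'))%type -> W}) : continuous f.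
Proof.
apply/linear_bounded_continuous/linear_boundedP.
pose f1 A := f (A, 0); pose f2 B := f (0, B).
have f1l : linear f1.
  move=> a A B; rewrite /f1 -linearP; congr (f _).
  by transitivity (a *: A + B, a *: (0 : 'M[R]_(m', n')) + 0); first rewrite scaler0 addr0.
have f2l : linear f2.
  move=> a A B; rewrite /f2 -linearP; congr (f _).
  by transitivity (a *: (0 : 'M[R]_(m, n)) + 0, a *: A + B); first rewrite scaler0 addr0.
pose F1 : {linear _ -> _} := HB.pack f1 (GRing.isLinear.Build _ _ _ _ _ f1l).
pose F2 : {linear _ -> _} := HB.pack f2 (GRing.isLinear.Build _ _ _ _ _ f2l).
near=> r => -[A B].
have -> : f (A, B) = F1 A + F2 B.
  by rewrite /F1 /F2/= /f1 /f2 -linearD; congr (f _);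
    transitivity (A + 0, 0 + B); first rewrite addr0 add0r.
apply: le_trans (ler_normD _ _) _.
apply: le_trans (lerD (mx_linear_le F1 A) (mx_linear_le F2 B)) _.
have A1 : `|A| <= `|(A, B)| by rewrite /Num.Def.normr/= le_max lexx.
have B1 : `|B| <= `|(A, B)| by rewrite /Num.Def.normr/= le_max lexx orbT.
apply: le_trans (lerD (ler_wpM2l _ A1) (ler_wpM2l _ B1)) _.
- by apply: sumr_ge0 => i _; apply: sumr_ge0.
- by apply: sumr_ge0 => i _; apply: sumr_ge0.
rewrite -mulrDl; apply: ler_wpM2r => //; near: r; apply: nbhs_pinfty_ge.
Unshelve. all: by end_near. Qed.

Lemma mx_norm_mulmx m n p (A : 'M[R]_(m, n)) (B : 'M[R]_(n, p)) :
  `|A *m B| <= n%:R * (`|A| * `|B|).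
Proof.
apply: norm_le_coord => [|i j]; first by rewrite !mulr_ge0.
rewrite mxE (le_trans (ler_norm_sum _ _ _))//.
apply: (@le_trans _ _ (\sum_(k < n) `|A| * `|B|)).
  by apply: ler_sum => k _; rewrite normrM ler_pM// coord_le_norm.
by rewrite sumr_const card_ord mulr_natl.
Qed.

Lemma mx_cvg (T : Type) (F : set_system T) (FF : Filter F) m n
    (f : T -> 'M[R]_(m, n)) (l : 'M[R]_(m, n)) :
  (forall i j, f t i j @[t --> F] --> l i j) -> f @ F --> l.
Proof.
move=> fl; apply/cvgrPdist_le => e e0.
have : \forall t \near F, forall i, forall j, `|l i j - f t i j| <= e.
  apply: filter_forall => i; apply: filter_forall => j.
  by move/cvgrPdist_le : (fl i j); exact.
apply: filterS => t te; apply: norm_le_coord => [|i j]; first exact: ltW.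
by rewrite !mxE te.
Qed.

Lemma cvg_mxE (T : Type) (F : set_system T) (FF : Filter F) m n
    (f : T -> 'M[R]_(m, n)) (l : 'M[R]_(m, n)) i j :
  f @ F --> l -> f t i j @[t --> F] --> l i j.
Proof.
move=> fl; exact: (cvg_comp f (fun A : 'M[R]_(m, n) => A i j) fl (@coord_continuous _ _ _ i j l)).
Qed.

(** Here [df] is a bare function: its linearity and continuity are recovered entry by entry from the
    scalar differentials. *)
Lemma mx_is_diff (V : normedModType R) m n (f df : V -> 'M[R]_(m, n)) x :
  (forall i j, is_diff x (fun y => f y i j) (fun h => df h i j)) ->
  is_diff x f df.
Proof.
move=> fij.
have dfl : linear df.
  move=> a u v; apply/matrixP => i j; rewrite !mxE.
  have [_ dE] := fij i j.
  have E h : 'd (fun y => f y i j) x h = df h i j by rewrite dE.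
  by rewrite -!E linearP.
pose DF : {linear _ -> _} := HB.pack df (GRing.isLinear.Build _ _ _ _ _ dfl).
apply: (@is_diff_small _ _ _ _ _ DF) => [u|e e0].
  apply: mx_cvg => i j /=; have [d dE] := fij i j.
  by have /= := @diff_continuous _ _ _ _ _ d u; rewrite /continuous_at dE.
have : \forall y \near x, forall i, forall j,
    `|f y i j - f x i j - df (y - x) i j| <= e * `|y - x|.
  apply: filter_forall => i; apply: filter_forall => j.
  have [d dE] := fij i j; have := differentiable_small d e0.
  by apply: filterS => y; rewrite dE.
apply: filterS => y ye; apply: norm_le_coord => [|i j].
  by apply: mulr_ge0 => //; exact: ltW.
by move: (ye i j); rewrite !mxE.
Qed.

(** By the Leibniz formula the determinant is a finite sum of finite products of entries. *)
Lemma det_cvg (T : Type) (F : set_system T) (FF : Filter F) n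
    (f : T -> 'M[R]_n) (l : 'M[R]_n) :
  f @ F --> l -> \det (f t) @[t --> F] --> \det l.
Proof.
move=> fl; apply: cvg_big => // [|s _]; first exact: add_continuous.
apply: cvgMl_tmp; apply: cvg_big => // [|i _]; first exact: mul_continuous.
exact: cvg_mxE.
Qed.

Lemma invmx_cvg (T : Type) (F : set_system T) (FF : Filter F) n
    (f : T -> 'M[R]_n) (l : 'M[R]_n) :
  l \in unitmx -> f @ F --> l -> invmx (f t) @[t --> F] --> invmx l.
Proof.
rewrite unitmxE unitfE => l0 fl; have dl := det_cvg FF fl.
have unear : \forall t \near F, \det (f t) != 0 by exact: (cvgr_neq0 _ dl).
apply: (@cvg_trans _ ((\det (f t))^-1 *: \adj (f t) @[t --> F])).
  (* [invmx] obeys the adjugate formula only on invertible matrices, so the two functions agree only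
     eventually along [F]. *)
  apply: near_eq_cvg; apply: filterS unear => t t0.
  by rewrite /invmx unitmxE unitfE t0.
rewrite /invmx unitmxE unitfE l0; apply: cvgZ; first exact: cvgV.
apply: mx_cvg => i j; rewrite mxE; under eq_fun do rewrite mxE.
apply: cvgMl_tmp; apply: det_cvg; apply: mx_cvg => i' j'.
by rewrite !mxE; under eq_fun do rewrite !mxE; exact: cvg_mxE.
Qed.

(* At a zero of [f] the product rule needs no differentiability of [g]. *)
Lemma is_diff_mulmx_zero (V : normedModType R) m n p
    (f df : V -> 'M[R]_(m, n)) (g : V -> 'M[R]_(n, p)) x :
  f x = 0 -> is_diff x f df -> {for x, continuous g} ->
  is_diff x (fun y => f y *m g y) (fun h => df h *m g x).
Proof.
move=> fx0 [fx <-] gx.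
have Ll : linear (fun h => 'd f x h *m g x).
  by move=> a u v; rewrite linearP mulmxDl scalemxAl.
pose L : {linear _ -> _} := HB.pack (fun h => 'd f x h *m g x)
  (GRing.isLinear.Build _ _ _ _ _ Ll).
apply: (@is_diff_small _ _ _ _ _ L) => [|e e0].
  have Lc : continuous (mulmxr (g x) \o 'd f x).
    move=> u; apply: continuous_comp; first exact: diff_continuous.
    exact: mx_linear_continuous.
  exact: Lc.
have [k k0 kdf] := linear_lipschitz (diff_continuous fx).
set G := `|g x|.
(* Each of the two error terms below receives [e / 2]. The factor [n] comes from the norm of a
   matrix product; [n + 1] and [G + 1] keep the denominators positive. The [min 1] in [e1] yields
   the bound [(k + 1) * |y - x|] on [|f y|]. *)
pose n1 : R := n%:R + 1.
have n10 : 0 < n1 by rewrite ltr_pwDr.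
pose e1 := Num.min 1 (e / (2 * n1 * (G + 1))).
have G0 : 0 <= G by exact: normr_ge0.
have e10 : 0 < e1.
  by rewrite lt_min ltr01 divr_gt0// !mulr_gt0// ltr_pwDr.
pose e2 := e / (2 * n1 * (k + 1)).
have e20 : 0 < e2 by rewrite divr_gt0// !mulr_gt0// addr_gt0.
move/cvgrPdist_le : (gx) => /(_ _ e20) gnear.
have := differentiable_small fx e10; apply: filterS2 gnear => y gy fy.
rewrite /L/= fx0 mul0mx subr0; rewrite fx0 subr0 in fy.
(* The first term is the remainder of [f]. In the second, [f y] is already of first order, so
   continuity of [g] makes the product negligible. *)
have -> : f y *m g y - 'd f x (y - x) *m g x =
   (f y - 'd f x (y - x)) *m g x + f y *m (g y - g x).
  by rewrite mulmxBl mulmxBr [RHS]addrC addrA subrK.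
have fyk : `|f y| <= (k + 1) * `|y - x|.
  rewrite -[f y](subrK ('d f x (y - x))) (le_trans (ler_normD _ _))//.
  rewrite addrC mulrDl lerD// mul1r (le_trans fy)//.
  by rewrite -[leRHS]mul1r ler_wpM2r// ge_min lexx.
apply: le_trans (ler_normD _ _) _.
have nn1 : n%:R <= n1 by rewrite lerDl.
rewrite [e]splitr mulrDl; apply: lerD; apply: le_trans (mx_norm_mulmx _ _) _.
  apply: (@le_trans _ _ (n1 * (e / (2 * n1 * (G + 1)) * `|y - x| * (G + 1)))).
    apply: ler_pM => //.
    apply: ler_pM => //; last by rewrite lerDl.
    by apply: le_trans fy _; rewrite ler_wpM2r// ge_min lexx orbT.
  have G10 : G + 1 != 0 by rewrite gt_eqF// ltr_pwDr.
  rewrite le_eqVlt; apply/predU1l; have := lt0r_neq0 n10.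
  by move: G10; move: (G + 1) (n1) => G1 n2 ? ?; field; apply/andP.
apply: (@le_trans _ _ (n1 * ((k + 1) * `|y - x| * (e / (2 * n1 * (k + 1)))))).
  apply: ler_pM => //.
  by apply: ler_pM => //; rewrite distrC.
have k10 : k + 1 != 0 by rewrite gt_eqF// addr_gt0.
rewrite le_eqVlt; apply/predU1l; have := lt0r_neq0 n10.
by move: k10; move: (k + 1) (n1) => G1 n2 ? ?; field; apply/andP.
Qed.

End matrix_space.

(** With [h = g z - g y], the expansion of [F] at [g y] says that [z - y] equals ['d F (g y) h] up
    to [d * |h|]. Applying [B] gives [|h - B (z - y)| <= k * d * |h|]; for small [d] this first
    bounds [|h|] by a multiple of [|z - y|], and then gives the expansion of [g]. *)
Lemma is_diff_local_inverse (R : realType) (V W : normedModType R)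
    (F : V -> W) (g : W -> V) (y : W) (B : {linear W -> V}) :
  {for y, continuous g} -> (\forall z \near y, F (g z) = z) ->
  differentiable F (g y) -> continuous B -> cancel ('d F (g y)) B ->
  is_diff y g B.
Proof.
move=> gc Fg dF Bc dFB; apply: is_diff_small => // e e0.
have [k k0 kB] := linear_lipschitz Bc.
(* The first bound gives [k * d <= 1/2], which absorbs [|h|] and leaves [|h| <= 2 * k * |z - y|];
   the second turns the remainder into [e * |z - y|]. *)
pose d := Num.min (2 * k)^-1 (e / (2 * k ^+ 2)).
have d0 : 0 < d by rewrite lt_min invr_gt0 divr_gt0 ?mulr_gt0 ?exprn_gt0.
have Fgy : F (g y) = y := nbhs_singleton Fg.
have := gc _ (differentiable_small dF d0); rewrite near_simpl.
apply: filterS2 Fg => z Fgz; rewrite /= Fgz Fgy => zy.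
set h := g z - g y.
have Bh : `|h - B (z - y)| <= k * (d * `|h|).
  rewrite -[h in h - _]dFB -linearB; apply: le_trans (kB _) _.
  by rewrite ler_pM2l// distrC.
have kd : k * d <= 2^-1.
  apply: (@le_trans _ _ (k * (2 * k)^-1)).
    by rewrite ler_pM2l// ge_min lexx.
  by rewrite invfM mulrCA mulfV ?gt_eqF// mulr1.
have hz : `|h| <= 2 * k * `|z - y|.
  have : `|h| <= `|h - B (z - y)| + `|B (z - y)|.
    by rewrite -{1}[h](subrK (B (z - y))) ler_normD.
  have := kB (z - y); have := ler_wpM2r (normr_ge0 h) kd.
  move: Bh; rewrite mulrA; lra.
apply: le_trans Bh _.
apply: (@le_trans _ _ (k * (e / (2 * k ^+ 2) * (2 * k * `|z - y|)))).
  rewrite ler_pM2l//; apply: ler_pM => //; first exact: ltW.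
  by rewrite ge_min lexx orbT.
have k1 : k != 0 by rewrite gt_eqF.
by rewrite le_eqVlt; apply/predU1l; field.
Qed.

(* Ostrowski's criterion: it suffices that some iterate of the derivative be a contraction, since [iter k L] is the derivative of [iter k F] at a fixed point. *)
Lemma iter_cvg_fixed_point (R : realType) (V : normedModType R) (F L : V -> V)
    (x : V) (k : nat) :
  (0 < k)%N -> F x = x -> is_diff x F L ->
  (forall h, `|iter k L h| <= 2^-1 * `|h|) ->
  \forall y \near x, iter n F y @[n --> \oo] --> x.
Proof.
move=> k0 Fx FL Lk.
have iterFx n : iter n F x = x by elim: n => //= n ->.
have diffn n : is_diff x (iter n F) (iter n L).
  elim: n => [|n IH]; first exact: is_diff_id.
  have FL' : is_diff (iter n F x) F L by rewrite iterFx.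
  exact: (@is_diff_comp _ _ _ _ _ _ _ _ _ IH FL').
have cont n : {for x, continuous (iter n F)}.
  by apply: differentiable_continuous; exact: ex_diff.
(* A linearization error of [1/4] added to the factor [1/2] of [iter k L] leaves the contraction
   factor [3/4]. *)
have e4 : 0 < 4^-1 :> R by [].
have [Fk FkE] := diffn k.
have := differentiable_small Fk e4; rewrite FkE iterFx.
move=> /nbhs_ballP[_/posnumP[d] contr].
have step y : `|y - x| < d%:num -> `|iter k F y - x| <= 3 / 4 * `|y - x|.
  move=> yd; have /contr : ball x d%:num y by rewrite -ball_normE/= distrC.
  move=> /= Ey; have := Lk (y - x).
  have : `|iter k F y - x| <= `|iter k F y - x - iter k L (y - x)| + `|iter k L (y - x)|.
    by rewrite -{1}(subrK (iter k L (y - x)) (iter k F y - x)) ler_normD.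
  lra.
have geom y i : `|y - x| < d%:num ->
    `|iter (i * k) F y - x| <= (3 / 4) ^+ i * `|y - x|.
  move=> yd; elim: i => [|i IH]; first by rewrite mul1r.
  have q1 : (3 / 4 : R) ^+ i <= 1 by apply: exprn_ile1; lra.
  have lt : `|iter (i * k) F y - x| < d%:num.
    apply: le_lt_trans IH _; apply: le_lt_trans yd.
    by rewrite -[leRHS]mul1r ler_wpM2r.
  rewrite mulSn iterD exprS -mulrA; apply: le_trans (step _ lt) _.
  by rewrite ler_pM2l.
apply/nbhs_ballP; exists d%:num => //= y; rewrite -ball_normE/= distrC => yd.
apply/cvgrPdist_lt => e e0.
(* Only multiples of [k] are controlled by the contraction. The remaining [r < k] steps are finitely
   many maps continuous at [x], so one neighbourhood serves them all. *)
have : \forall z \near x, forall r : 'I_k, `|x - iter r F z| < e.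
  apply: filter_forall => r; have /cvgrPdist_lt/(_ e e0) := cont r.
  by rewrite iterFx.
move=> /nbhs_ballP[_/posnumP[c] near_c].
have geo0 : (3 / 4 : R) ^+ i * `|y - x| @[i --> \oo] --> 0.
  rewrite -[X in _ --> X](mul0r `|y - x|); apply: cvgMr_tmp.
  by apply: cvg_expr; rewrite ger0_norm; lra.
move/cvgrPdist_lt : geo0 => /(_ _ (gt0 c))[i0 _ small].
exists (i0 * k)%N => //= n ni.
rewrite (divn_eq n k) addnC iterD.
have /= := near_c (iter (n %/ k * k) F y) _ (Ordinal (ltn_pmod n k0)); apply.
rewrite -ball_normE/= distrC; apply: le_lt_trans (geom _ _ yd) _.
have /= := small (n %/ k)%N; rewrite sub0r normrN ger0_norm; last first.
  by rewrite mulr_ge0// exprn_ge0//; lra.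
by apply; rewrite leq_divRL.
Qed.

(* The lower bound comes from the minimum of the norm over the sup-norm unit sphere. *)
Lemma norm_equiv_rV (R : realType) n (nrm : 'rV[R]_n -> R) : is_norm nrm ->
  exists2 C, 0 < C & forall x, nrm x <= C * `|x| /\ `|x| <= C * nrm x.
Proof.
move=> [nrmD nrmZ nrm0].
have nrm00 : nrm 0 = 0 by rewrite -(scale0r 0) nrmZ normr0 mul0r.
have nrmN x : nrm (- x) = nrm x by rewrite -scaleN1r nrmZ normrN1 mul1r.
have nrm_ge0 x : 0 <= nrm x.
  have := nrmD x (- x); rewrite subrr nrm00 nrmN; lra.
have nrm_sum (I : finType) (f : I -> 'rV[R]_n) : nrm (\sum_i f i) <= \sum_i nrm (f i).
  elim/big_rec2: _ => [|i x y _ xy]; first by rewrite nrm00.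
  by apply: le_trans (nrmD _ _) _; rewrite lerD2l.
pose C1 := \sum_j nrm (delta_mx 0 j).
have C1_ge0 : 0 <= C1 by apply: sumr_ge0.
have upper x : nrm x <= C1 * `|x|.
  rewrite {1}(row_sum_delta x); apply: le_trans (nrm_sum _ _) _.
  rewrite mulr_suml; apply: ler_sum => j _.
  by rewrite nrmZ mulrC ler_wpM2l// coord_le_norm.
have nrmB x y : `|nrm x - nrm y| <= nrm (x - y).
  have := nrmD (y - x) x; rewrite subrK -(nrmN (y - x)) opprB => yx.
  have := nrmD (x - y) y; rewrite subrK => xy.
  by rewrite ler_norml; apply/andP; split; lra.
have nrm_cont : continuous nrm.
  move=> x; apply/(@cvgrPdist_le _ _ _ (nbhs x)) => e e0.
  have C10 : 0 < C1 + 1 by rewrite ltr_pwDr.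
  have e1 : 0 < e / (C1 + 1) by rewrite divr_gt0.
  apply: filterS (nbhsx_ballx x _ e1) => y; rewrite -ball_normE /= => /ltW xy.
  apply: le_trans (nrmB _ _) _; apply: le_trans (upper _) _.
  move: xy; rewrite ler_pdivlMr// mulrC => /(le_trans _); apply.
  by rewrite ler_wpM2r// lerDl.
(* In dimension zero the unit sphere is empty and the minimum does not exist, but the only vector is
   zero. *)
have [[j _]|n0] := pselect (exists j : 'I_n, True); last first.
  exists 1 => // x; suff -> : x = 0 by rewrite nrm00 normr0 mulr0.
  by apply/rowP => j; case: n0; exists j.
pose S := [set x : 'rV[R]_n | `|x| = 1].
have Sc : compact S.
  apply: bounded_closed_compact.
    by exists 1; split => // M M1 x /= ->; exact: ltW.
  apply: (@preimage_closed _ _ (Num.norm : 'rV[R]_n -> R) [set x | x = 1]).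
    by move=> x _; exact: norm_continuous.
  exact: closed_eq.
have normS x : x != 0 -> S (`|x|^-1 *: x).
  by move=> x0; rewrite /S/= normfZV.
have d0 : delta_mx 0 j != 0 :> 'rV[R]_n.
  by apply/eqP => /matrixP/(_ 0 j); rewrite !mxE !eqxx => /eqP; rewrite oner_eq0.
have [c /set_mem cS cmin] := compact_EVT_min (ex_intro _ _ (normS _ d0)) Sc
  (continuous_subspaceT nrm_cont).
have c0 : 0 < nrm c.
  rewrite lt0r nrm_ge0 andbT; apply/eqP => /nrm0 cz.
  by move: cS; rewrite /S/= cz normr0 => /esym/eqP; rewrite oner_eq0.
exists (C1 + (nrm c)^-1) => [|x]; first by rewrite ltr_wpDl ?invr_gt0.
split.
  by apply: le_trans (upper x) _; rewrite ler_wpM2r// lerDl invr_ge0 ltW.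
apply: (@le_trans _ _ ((nrm c)^-1 * nrm x)); last by rewrite ler_wpM2r// lerDr.
have [->|x0] := eqVneq x 0; first by rewrite normr0 mulr_ge0// invr_ge0 ltW.
have := cmin _ (mem_set (normS _ x0)).
rewrite nrmZ ger0_norm ?invr_ge0// ler_pdivlMl ?normr_gt0// => cx.
by rewrite ler_pdivlMl// mulrC.
Unshelve. all: by end_near. Qed.

(** The equivalence is transported from row vectors along the isomorphism [phi], whose continuity is
    automatic; below, a pair of matrices is flattened into one row. *)
Lemma norm_equiv (R : realType) (V : normedModType R) n
    (phi : {linear 'rV[R]_n -> V}) (psi : {linear V -> 'rV[R]_n})
    (nrm : V -> R) :
  continuous psi -> cancel phi psi -> cancel psi phi -> is_norm nrm ->
  exists2 C, 0 < C & forall x, nrm x <= C * `|x| /\ `|x| <= C * nrm x.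
Proof.
move=> psic phiK psiK [nrmD nrmZ nrm0].
have [C C0 CP] : exists2 C, 0 < C & forall x, nrm (phi x) <= C * `|x| /\ `|x| <= C * nrm (phi x).
  apply: (@norm_equiv_rV _ _ (nrm \o phi)); split => /=.
  - by move=> x y; rewrite linearD; exact: nrmD.
  - by move=> a x; rewrite linearZ; exact: nrmZ.
  - by move=> x /nrm0 phx; rewrite -(phiK x) phx linear0.
have [a a0 aP] := linear_lipschitz psic.
have [b b0 bP] := linear_lipschitz (mx_linear_continuous (f := phi)).
exists ((a + b) * C) => [|x]; first by rewrite mulr_gt0// addr_gt0.
have [up low] := CP (psi x); rewrite psiK in up low.
have n0 : 0 <= nrm x by rewrite -(pmulr_rge0 _ C0) (le_trans _ low).
split.
  apply: le_trans up _; rewrite [(a + b) * C]mulrC -mulrA ler_pM2l//.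
  by apply: le_trans (aP x) _; rewrite ler_wpM2r// lerDl ltW.
rewrite -[x in leLHS]psiK; apply: le_trans (bP _) _.
rewrite -mulrA; apply: (@le_trans _ _ ((a + b) * `|psi x|)).
  by rewrite ler_wpM2r// lerDr ltW.
by rewrite ler_pM2l// addr_gt0.
Qed.

Lemma norm_equiv_mx_pair (R : realType) m n m' n'
    (nrm : 'M[R]_(m, n) * 'M[R]_(m', n') -> R) : is_norm nrm ->
  exists2 C, 0 < C & forall x, nrm x <= C * `|x| /\ `|x| <= C * nrm x.
Proof.
pose phi (w : 'rV[R]_(m * n + m' * n')) :=
  (vec_mx (lsubmx w) : 'M[R]_(m, n), vec_mx (rsubmx w) : 'M[R]_(m', n')).
pose psi (x : 'M[R]_(m, n) * 'M[R]_(m', n')) := row_mx (mxvec x.1) (mxvec x.2).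
have phil : linear phi.
  by move=> a x y; rewrite /phi !linearP.
have psil : linear psi.
  by move=> a x y; rewrite /psi !linearP scale_row_mx add_row_mx.
pose Phi : {linear _ -> _} := HB.pack phi (GRing.isLinear.Build _ _ _ _ _ phil).
pose Psi : {linear _ -> _} := HB.pack psi (GRing.isLinear.Build _ _ _ _ _ psil).
apply: (@norm_equiv _ _ _ Phi Psi).
- exact: mx_pair_linear_continuous.
- by move=> w; rewrite /Psi /Phi/= /psi /phi/= !vec_mxK hsubmxK.
- by case=> A B; rewrite /Psi /Phi/= /psi /phi/= row_mxKl row_mxKr !mxvecK.
Qed.

(** Pointwise convergence on the finitely many matrix units already controls the operator norm. *)
Lemma iter_mx_linear_uniform (R : realType) m n (J : {linear 'M[R]_(m, n) -> 'M[R]_(m, n)}) :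
  (forall A, iter k J A @[k --> \oo] --> (0 : 'M[R]_(m, n))) ->
  forall e, 0 < e -> \forall k \near \oo, forall A, `|iter k J A| <= e * `|A|.
Proof.
move=> J0 e e0.
pose c : R := (m * n)%:R + 1.
have c0 : 0 < c by rewrite ltr_pwDr.
have ec : 0 < e / c by rewrite divr_gt0.
have : \forall k \near \oo, forall i j, `|iter k J (delta_mx i j)| <= e / c.
  apply: filter_forall => i; apply: filter_forall => j.
  move/cvgrPdist_le : (J0 (delta_mx i j)) => /(_ _ ec); apply: filterS => k.
  by rewrite sub0r normrN.
apply: filterS => k kec A.
have Jl : linear (iter k J).
  by move=> a x y; elim: k {kec} => //= k ->; rewrite linearP.
pose JL : {linear _ -> _} := HB.pack (iter k J) (GRing.isLinear.Build _ _ _ _ _ Jl).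
apply: le_trans (mx_linear_le JL A) _; apply: ler_wpM2r => //.
apply: (@le_trans _ _ (\sum_(i < m) \sum_(j < n) e / c)).
  by apply: ler_sum => i _; apply: ler_sum => j _; exact: kec.
rewrite !sumr_const !card_ord -mulrnA -[_ *+ _]mulr_natl mulrCA -[leRHS]mulr1.
by rewrite ler_pM2l// ler_pdivrMr// mul1r mulnC lerDl.
Qed.

(** * Spectral radius and powers *)

Local Notation normc := ComplexField.Normc.normc.

(** Once [e n <= (1 - q) * (eps / 2)], the level [eps / 2] is invariant under the recursion, and the
    excess over it decays like [q ^+ k]. *)
Lemma cvg0_affine_recursion (R : realType) (q : R) (a e : R ^nat) :
  0 <= q < 1 -> (forall n, 0 <= a n) ->
  (forall n, a n.+1 <= q * a n + e n) ->
  e @ \oo --> 0 -> a @ \oo --> 0.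
Proof.
move=> /andP[q0 q1] a0 arec ecvg; apply/cvgrPdist_le => eps eps0.
have q1' : 0 < 1 - q by rewrite subr_gt0.
have d0 : 0 < (1 - q) * (eps / 2) by rewrite mulr_gt0// divr_gt0.
move/cvgrPdist_le : ecvg => /(_ _ d0)[n0 _ en0].
have aq k : a (n0 + k)%N <= q ^+ k * a n0 + eps / 2.
  elim: k => [|k IH]; first by rewrite addn0 expr0 mul1r lerDl divr_ge0 ?ltW.
  rewrite addnS; apply: le_trans (arec _) _.
  have : e (n0 + k)%N <= (1 - q) * (eps / 2).
    have /= := en0 (n0 + k)%N (leq_addr _ _); rewrite sub0r normrN.
    exact/le_trans/ler_norm.
  move: (ler_wpM2l q0 IH); rewrite exprS -mulrA.
  move: (q ^+ k * a n0) (q * (eps/2)) => x y; nra.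
have geo : (q ^+ k * a n0) @[k --> \oo] --> 0.
  rewrite -[X in _ --> X](mul0r (a n0)); apply: cvgMr_tmp.
  by apply: cvg_expr; rewrite ger0_norm.
have e20 : 0 < eps / 2 by rewrite divr_gt0.
move/cvgrPdist_le : geo => /(_ _ e20)[n1 _ gn1].
exists (n0 + n1)%N => //= n n0n; rewrite sub0r normrN ger0_norm//.
have n0n' : (n0 <= n)%N by rewrite (leq_trans _ n0n)// leq_addr.
have := aq (n - n0)%N; rewrite subnKC//.
have /= := gn1 (n - n0)%N; rewrite leq_subRL// => /(_ n0n).
rewrite sub0r normrN => /(le_trans (ler_norm _)); lra.
Qed.

Lemma normc_ge0 (R : rcfType) (z : R[i]) : 0 <= normc z.
Proof. by case: z => x y; exact: sqrtr_ge0. Qed.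

Lemma normc_real (R : rcfType) (x : R) : normc (x%:C)%C = `|x|.
Proof. by rewrite /ComplexField.Normc.normc/= expr0n addr0 sqrtr_sqr. Qed.

(* Peeling one factor of the annihilating product at a time reduces the claim to the scalar recursion [a_(n+1) <= |z| a_n + e_n]. *)
Lemma cvg0_annihilated (R : realType) (n : nat) (A : 'M[R[i]]_n.+1)
    (r : seq R[i]) (w : 'rV[R[i]]_n.+1) :
  all (fun z => normc z < 1) r ->
  w *m horner_mx A (\prod_(z <- r) ('X - z%:P)) = 0 ->
  forall j, normc ((w *m A ^+ k) 0 j) @[k --> \oo] --> (0 : R).
Proof.
elim: r w => [|z r IH] w /=.
  rewrite big_nil rmorph1 mulmx1 => _ -> j.
  under eq_fun do rewrite mul0mx mxE ComplexField.Normc.normc0.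
  exact: cvg_cst.
case/andP=> z1 r1; rewrite big_cons rmorphM/= mulmxA => wr j.
apply: (@cvg0_affine_recursion _ (normc z) _
  (fun k => normc ((w *m horner_mx A ('X - z%:P) *m A ^+ k) 0 j))).
- by rewrite normc_ge0.
- by move=> k; exact: normc_ge0.
(* The recursion is the triangle inequality for [w A^(k+1) = z w A^k + w (A - z) A^k]. *)
- move=> k; rewrite -ComplexField.Normc.normcM.
  apply: le_trans (le_normcD _ _); rewrite le_eqVlt; apply/predU1l; congr normc.
  rewrite rmorphB/= horner_mx_X horner_mx_C mulmxBr mulmxBl -(mulmxA w A).
  have -> : A *m A ^+ k = A ^+ k.+1 by rewrite exprS.
  rewrite mul_mx_scalar -scalemxAl.
  move: (w *m A ^+ k.+1) (w *m A ^+ k) => x y.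
  by rewrite !mxE addrC addrA subrr add0r.
- exact: IH r1 wr j.
Qed.

(** A supremum dominates its set only if the set is bounded: the eigenvalues are the roots of the
    characteristic polynomial, split over [R[i]], and the sum of the moduli of these roots is a
    bound. *)
Lemma le_spectral_radius (R : realType) n (A : 'M[R]_n) (z : R[i]) :
  eigenvalue (map_mx (real_complex R) A) z ->
  normc z <= spectral_radius A.
Proof.
move=> Az; apply: ub_le_sup; last by exists z.
have [r rE] := closed_field_poly_normal (char_poly (map_mx (real_complex R) A)).
exists (\sum_(y <- r) normc y) => _ [y /= + <-].
rewrite eigenvalue_root_char rE (monicP (char_poly_monic _)) scale1r.
rewrite root_prod_XsubC => yr.
rewrite (big_rem y)//= lerDl; apply: sumr_ge0 => *; exact: normc_ge0.
Qed.

(** By Cayley-Hamilton the split characteristic polynomial annihilates [A], and all its roots have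
    modulus below one, so [cvg0_annihilated] applies without a Jordan form. *)
Lemma iter_mulmxr_cvg0 (R : realType) n (A : 'M[R]_n) (u : 'rV[R]_n) :
  spectral_radius A < 1 -> iter k (mulmxr A) u @[k --> \oo] --> (0 : 'rV[R]_n).
Proof.
case: n A u => [|n] A u A1.
  apply: cvg_near_cst; near=> k; exact: thinmx0.
have iterE k : iter k (mulmxr A) u = u *m A ^+ k.
  elim: k => [|k IH]; first by rewrite mulmx1.
  by rewrite iterS IH/= -mulmxA exprSr.
have [r rE] := closed_field_poly_normal (char_poly (map_mx (real_complex R) A)).
rewrite (monicP (char_poly_monic _)) scale1r in rE.
have uj j : (u *m A ^+ k) 0 j @[k --> \oo] --> (0 : R).
  apply/norm_cvg0P.
  have := @cvg0_annihilated _ _ (map_mx (real_complex R) A) r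
    (map_mx (real_complex R) u) _ _ j.
  rewrite -rE Cayley_Hamilton mulmx0.
  have -> : (fun k => normc ((map_mx (real_complex R) u
     *m map_mx (real_complex R) A ^+ k) 0 j)) = (fun k => `|(u *m A ^+ k) 0 j|).
    apply/funext => k.
    by rewrite -rmorphXn -map_mxM mxE normc_real.
  apply => //.
  apply/allP => z; rewrite -root_prod_XsubC -rE -eigenvalue_root_char => Az.
  exact: le_lt_trans (le_spectral_radius Az) A1.
apply/cvgrPdist_le => e e0.
have : \forall k \near \oo, forall j, `|(u *m A ^+ k) 0 j| <= e.
  apply: filter_forall => j; move/cvgrPdist_le : (uj j) => /(_ _ e0).
  by apply: filterS => k; rewrite sub0r normrN.
apply: filterS => k ek; rewrite sub0r normrN iterE /Num.Def.normr/= mx_normrE.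
apply: bigmax_le; first exact: ltW.
by case=> i j _ /=; rewrite (ord1 i).
Unshelve. all: by end_near. Qed.

Lemma iter_linear_spectral_cvg0 (R : realType) a b
    (J : {linear 'M[R]_(a, b) -> 'M[R]_(a, b)}) A :
  spectral_radius (lin_mx J) < 1 ->
  iter k J A @[k --> \oo] --> (0 : 'M[R]_(a, b)).
Proof.
move=> /(iter_mulmxr_cvg0 (mxvec A)) rho.
have iterE k : iter k J A = vec_mx (iter k (mulmxr (lin_mx J)) (mxvec A)).
  elim: k => [|k IH]; first by rewrite mxvecK.
  by rewrite !iterS IH; apply: (can_inj mxvecK); rewrite vec_mxK/= -mul_vec_lin vec_mxK.
have -> : (fun k => iter k J A) = (fun k => vec_mx (iter k (mulmxr (lin_mx J)) (mxvec A))).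
  exact/funext.
rewrite -[X in _ --> X](linear0 (@vec_mx R a b)).
exact: (cvg_comp _ _ rho (mx_linear_continuous (f := @vec_mx R a b) (x := _))).
Qed.

(* The block operator ignores its first component, so its powers are governed by those of [D \o E]. *)
Lemma iter_block_contraction (R : realType) a b
    (E D : {linear 'M[R]_(a, b) -> 'M[R]_(a, b)}) :
  spectral_radius (lin_mx (D \o E)) < 1 ->
  exists2 n, (0 < n)%N &
    forall h, `|iter n (fun h => (E h.2, D (E h.2))) h| <= 2^-1 * `|h|.
Proof.
move=> rho.
pose J : {linear 'M[R]_(a, b) -> 'M[R]_(a, b)} := D \o E.
have Jn := iter_mx_linear_uniform (fun A => iter_linear_spectral_cvg0 A (J := J) rho).
have [c c0 cE] := linear_lipschitz (mx_linear_continuous (f := E)).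
(* [1/2] handles the second component; the first carries an extra factor [E] of norm at most [c]. *)
pose e := Num.min 2^-1 (2 * c)^-1.
have e0 : 0 < e by rewrite lt_min !invr_gt0 mulr_gt0 ?andbT.
have [n0 _ small] := Jn _ e0.
(* The first component of the power [n.+1] contains only [n] factors of [J], hence the shift by
   one. *)
exists n0.+1 => // -[h k].
have iterE n : iter n.+1 (fun h => (E h.2, D (E h.2))) (h, k) = (E (iter n J k), iter n.+1 J k).
  by elim: n => [//|n IH]; rewrite iterS IH /=.
rewrite iterE.
have kh : `|k| <= `|(h, k)| by rewrite [leRHS]/Num.Def.normr/= le_max lexx orbT.
apply: le_trans (ler_wpM2l _ kh); last by rewrite invr_ge0.
have e2 : e <= 2^-1 by rewrite ge_min lexx.
have ec : c * e <= 2^-1.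
  apply: (@le_trans _ _ (c * (2 * c)^-1)); first by rewrite ler_pM2l// ge_min lexx orbT.
  by rewrite invfM mulrCA mulfV ?gt_eqF// mulr1.
rewrite [leLHS]/Num.Def.normr/= ge_max; apply/andP; split.
  apply: le_trans (cE _) _; apply: (@le_trans _ _ (c * (e * `|k|))).
    by rewrite ler_pM2l//; apply: (small n0); rewrite /= leqnn.
  by rewrite mulrA ler_wpM2r.
apply: (@le_trans _ _ (e * `|k|)); last by rewrite ler_wpM2r.
by apply: (small n0.+1); rewrite /= leqnSn.
Qed.

Lemma dominated_norm_cvg0 (R : realType) (V : normedModType R) (nrm : V -> R) K
    (u : nat -> V) (l : V) :
  (forall x, 0 <= nrm x <= K * `|x|) -> u @ \oo --> l ->
  nrm (u n - l) @[n --> \oo] --> (0 : R).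
Proof.
move=> nrmK ul.
apply: (@squeeze_cvgr _ _ _ _ (fun=> 0) (fun n => K * `|u n - l|)).
- by apply: nearW => n; exact: nrmK.
- exact: cvg_cst.
- rewrite -[X in _ --> X](mulr0 K); apply: cvgMl_tmp; apply/norm_cvg0P.
  exact/subr_cvg0.
Qed.

Lemma is_diff_jac (R : realType) n k n' k' (F df : 'M[R]_(n, k) -> 'M[R]_(n', k')) x :
  is_diff x F df -> jac F x = lin_mx df.
Proof. by case=> _ dE; rewrite /jac dE. Qed.

(** * Legendre transform *)

Section gradient.
Context {R : realType}.

Lemma diff_gradE n k (F : 'M[R]_(n, k) -> R) x h : differentiable F x ->
  'd F x h = \sum_i \sum_j h i j * grad F x i j.
Proof.
move=> Fx; rewrite linear_mxE; apply: eq_bigr => i _; apply: eq_bigr => j _.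
by rewrite mxE deriveE.
Qed.

Lemma diff_gradE_col n (F : 'cV[R]_n -> R) x h : differentiable F x ->
  'd F x h = (h^T *m grad F x) 0 0.
Proof.
move=> Fx; rewrite diff_gradE// mxE; apply: eq_bigr => i _.
by rewrite big_ord1; congr (_ * _); rewrite mxE.
Qed.

(** First-order conditions follow from this one-sided expansion after division by [t > 0]. *)
Lemma diff_along (V : normedModType R) (F : V -> R) x h e :
  differentiable F x -> 0 < e ->
  \forall t \near (0 : R)^'+, `|F (x + t *: h) - F x - t * 'd F x h| <= t * e.
Proof.
move=> Fx e0.
have h1 : 0 < `|h| + 1 by rewrite ltr_pwDr.
have e1 : 0 < e / (`|h| + 1) by rewrite divr_gt0.
have /nbhs_ballP[_/posnumP[d] small] := differentiable_small Fx e1.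
near=> t.
have t0 : 0 < t by near: t; exact: nbhs_right_gt.
have /small : ball x d%:num (x + t *: h).
  rewrite -ball_normE/= opprD addrA subrr sub0r normrN normrZ gtr0_norm//.
  apply: (@lt_le_trans _ _ (t * (`|h| + 1))); first by rewrite ltr_pM2l// ltrDl.
  rewrite -ler_pdivlMr//; near: t; apply: nbhs_right_le.
  by rewrite divr_gt0.
have xE : x + t *: h - x = t *: h by rewrite addrC addKr.
rewrite /= xE linearZ/= => /le_trans; apply.
rewrite normrZ gtr0_norm// mulrCA ler_pM2l//.
by rewrite mulrAC ler_pdivrMr// ler_pM2l// lerDl.
Unshelve. all: by end_near. Qed.

(** The one-sided expansion makes the differential nonnegative in every direction, in particular
    along [h] and [- h]. *)
Lemma diff_at_min (V : normedModType R) (F : V -> R) x h :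
  differentiable F x -> (forall y, F x <= F y) -> 'd F x h = 0.
Proof.
move=> Fx Fmin.
have ge0 v : 0 <= 'd F x v.
  apply/ler_addgt0Pr => e e0; near (0 : R)^'+ => t.
  have t0 : 0 < t by near: t; exact: nbhs_right_gt.
  have : `|F (x + t *: v) - F x - t * 'd F x v| <= t * e.
    by near: t; exact: diff_along.
  have := Fmin (x + t *: v); rewrite ler_norml => Fm /andP[_ Fe].
  rewrite -(pmulr_rge0 _ t0) mulrDr; lra.
apply/le_anti/andP; split => //.
by rewrite -oppr_ge0 -linearN.
Unshelve. all: by end_near. Qed.

(** The convexity inequality at [u + t (v - u)] is compared with the first-order expansion there and
    divided by [t]. *)
Lemma convex_above_tangent n (F : 'cV[R]_n -> R) u v :
  strictly_convex F -> differentiable F u ->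
  F u + ((v - u)^T *m grad F u) 0 0 <= F v.
Proof.
move=> Fconv Fu; rewrite -diff_gradE_col//.
have [->|vu] := eqVneq v u; first by rewrite subrr linear0 addr0.
apply/ler_addgt0Pr => e e0; near (0 : R)^'+ => t.
have t0 : 0 < t by near: t; exact: nbhs_right_gt.
have t1 : t < 1 by near: t; exact: nbhs_right_lt.
have : `|F (u + t *: (v - u)) - F u - t * 'd F u (v - u)| <= t * e.
  by near: t; exact: diff_along.
have := Fconv v u t vu; rewrite t0 t1 => /(_ isT).
have -> : t *: v + (1 - t) *: u = u + t *: (v - u).
  by rewrite scalerBl scale1r scalerBr addrCA.
rewrite ler_norml => conv /andP[low _].
rewrite -(ler_pM2l t0) !mulrDr; lra.
Unshelve. all: by end_near. Qed.

Lemma colmx_dotC n (a b : 'cV[R]_n) : (a^T *m b) 0 0 = (b^T *m a) 0 0.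
Proof. by rewrite !mxE; apply: eq_bigr => i _; rewrite !mxE mulrC. Qed.

Lemma colmx_dotBr n (a b c : 'cV[R]_n) :
  (a^T *m (b - c)) 0 0 = (a^T *m b) 0 0 - (a^T *m c) 0 0.
Proof. by rewrite mulmxBr mxE [X in _ + X]mxE. Qed.

Lemma colmx_dotBl n (a b c : 'cV[R]_n) :
  ((a - b)^T *m c) 0 0 = (a^T *m c) 0 0 - (b^T *m c) 0 0.
Proof. by rewrite (colmx_dotC (a - b)) colmx_dotBr (colmx_dotC a) (colmx_dotC b). Qed.

Section legendre_gradient.
Context {n : nat} (F : 'cV[R]_n -> R).
Hypothesis F_convex : strictly_convex F.
Hypothesis F_diff : forall u, differentiable F u.
Variable g : 'cV[R]_n -> 'cV[R]_n.
Hypothesis gradK : cancel g (grad F).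

(** This is the tangent inequality at [g v], where the gradient is [v]; it shows that the supremum
    in the transform is attained at [g v]. *)
Lemma legendre_ub v u : (v^T *m u) 0 0 - F u <= (v^T *m g v) 0 0 - F (g v).
Proof.
have := convex_above_tangent u F_convex (F_diff (g v)).
rewrite gradK colmx_dotC (colmx_dotBr v); lra.
Qed.

Lemma legendreE v : legendre F v = (v^T *m g v) 0 0 - F (g v).
Proof.
apply/le_anti/andP; split.
  apply: ge_sup; first by exists ((v^T *m g v) 0 0 - F (g v)), (g v).
  by move=> _ [u _ <-]; exact: legendre_ub.
apply: ub_le_sup; last by exists (g v).
by exists ((v^T *m g v) 0 0 - F (g v)) => _ [u _ <-]; exact: legendre_ub.
Qed.

(* The increment of the transform over [w - v] lies between the pairings of [w - v] with [g v] and with [g w]. *)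
Lemma legendre_is_diff v : {for v, continuous g} ->
  is_diff v (legendre F) (fun h => (h^T *m g v) 0 0).
Proof.
move=> gv.
have Ll : linear (fun h : 'cV[R]_n => (h^T *m g v) 0 0 : R).
  by move=> a x y; rewrite linearP mulmxDl -scalemxAl !mxE.
pose L : {linear _ -> _} := HB.pack (fun h : 'cV[R]_n => (h^T *m g v) 0 0 : R)
  (GRing.isLinear.Build _ _ _ _ _ Ll).
apply: (@is_diff_small _ _ _ _ _ L) => [|e e0].
  exact: mx_linear_continuous.
have n1 : 0 < n%:R + 1 :> R by rewrite ltr_pwDr.
have e1 : 0 < e / (n%:R + 1) by rewrite divr_gt0.
move/cvgrPdist_le : gv => /(_ _ e1); apply: filterS => w gw.
rewrite /L/= !legendreE.
have vw := legendre_ub v (g w).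
have wv := legendre_ub w (g v).
(* The upper and lower bounds on the increment differ by this pairing, so continuity of [g]
   suffices. *)
have bound : `|((w - v)^T *m (g w - g v)) 0 0| <= e * `|w - v|.
  apply: le_trans (coord_le_norm _ _ _) _.
  apply: le_trans (mx_norm_mulmx _ _) _.
  have tr : `|(w - v)^T| <= `|w - v|.
    by apply: norm_le_coord => // i j; rewrite mxE coord_le_norm.
  apply: (@le_trans _ _ (n%:R * (`|w - v| * (e / (n%:R + 1))))).
    by rewrite ler_wpM2l// ler_pM// distrC.
  rewrite mulrCA mulrC ler_wpM2r// mulrCA ger_pMr//.
  by rewrite ler_pdivrMr// mul1r lerDl.
rewrite colmx_dotBr !colmx_dotBl in bound *.
apply: le_trans bound; rewrite (le_trans _ (ler_norm _))// ler_norml.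
by apply/andP; split; lra.
Qed.

End legendre_gradient.
End gradient.

(** * Derivatives of finite sums, linear images and matrix entries *)

Section is_diff_rules.
Context {R : realType}.

Lemma is_diff_sum (V W : normedModType R) (I : Type) (r : seq I)
    (f df : I -> V -> W) x :
  (forall i, is_diff x (f i) (df i)) ->
  is_diff x (fun y => \sum_(i <- r) f i y) (fun h => \sum_(i <- r) df i h).
Proof.
move=> fi; elim: r => [|i r IH].
  under eq_fun do rewrite big_nil.
  under [X in is_diff _ _ X]eq_fun do rewrite big_nil.
  exact: is_diff_cst.
under eq_fun do rewrite big_cons.
under [X in is_diff _ _ X]eq_fun do rewrite big_cons.
exact: (@is_diffD _ _ _ _ _ _ _ _ (fi i) IH).
Qed.

Lemma is_diff_linear_comp (V : normedModType R) m n (W : normedModType R)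
    (L : {linear 'M[R]_(m, n) -> W}) (f df : V -> 'M[R]_(m, n)) x :
  is_diff x f df -> is_diff x (L \o f) (L \o df).
Proof.
move=> fx; have Lx := mx_linear_is_diff L (f x).
exact: (@is_diff_comp _ _ _ _ _ _ _ _ _ fx Lx).
Qed.

Lemma is_diff_coord (V : normedModType R) m n (f df : V -> 'M[R]_(m, n)) x i j :
  is_diff x f df -> is_diff x (fun y => f y i j) (fun h => df h i j).
Proof.
move=> fx.
have Ll : linear (fun A : 'M[R]_(m, n) => A i j : R) by move=> a A B; rewrite !mxE.
pose L : {linear _ -> _} := HB.pack (fun A : 'M[R]_(m, n) => A i j : R)
  (GRing.isLinear.Build _ _ _ _ _ Ll).
exact: (@is_diff_linear_comp _ _ _ _ L).
Qed.

End is_diff_rules.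

(** * The IPM iteration *)

Lemma lin_mx_cvg (R : realType) (T : Type) (F : set_system T) (FF : Filter F)
    m n m' n' (f : T -> 'M[R]_(m, n) -> 'M[R]_(m', n')) (l : 'M[R]_(m, n) -> 'M[R]_(m', n')) :
  (forall h, f t h @[t --> F] --> l h) ->
  lin_mx (f t) @[t --> F] --> lin_mx l.
Proof.
move=> fl; apply: mx_cvg => i j; pose h : 'M[R]_(m, n) := vec_mx (delta_mx 0 i).
have lin_mxE D : lin_mx D i j = mxvec (D h) 0 j by rewrite mxE.
have -> : (fun t => lin_mx (f t) i j) = (fun t => mxvec (f t h) 0 j).
  by apply/funext => t; exact: lin_mxE.
rewrite lin_mxE; apply: cvg_mxE.
exact: (cvg_comp _ _ (fl h) (mx_linear_continuous (f := @mxvec R m' n') (x := _))).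
Qed.

(** * The moment map, the gradient and Hessian of the dual function, and the Newton map *)

Section ipm_calculus.
Context {R : realType} {m p M Q : nat} (S : ipm_data R m p M Q).
Local Notation N := 'C(M + p, p).
Local Notation moments := 'M[R]_('C(M + p, p), m).

(** Common shape of the moment map and of every term of [fv_update]; being linear in [h], it passes
    limits and derivatives through the quadrature. *)
Definition moment_of (h : p.-tuple R -> 'cV[R]_m) : moments :=
  (quad S (fun x => h x *m (basis_vec S x)^T))^T.

Lemma moment_of_is_diff (V : normedModType R) (f df : p.-tuple R -> V -> 'cV[R]_m) x :
  (forall k, is_diff x (f (node S k)) (df (node S k))) ->
  is_diff x (fun y => moment_of (f ^~ y)) (fun h => moment_of (df ^~ h)).
Proof.
move=> fk.
apply: (@is_diff_linear_comp _ _ _ _ _ (@trmx R m N)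
  (fun y => quad S (fun x => f x y *m (basis_vec S x)^T))
  (fun h => quad S (fun x => df x h *m (basis_vec S x)^T))).
apply: is_diff_sum => k.
exact: (@is_diff_linear_comp _ _ _ _ _
  ( *:%R (weight S k * joint_density S (node S k)) \o mulmxr (basis_vec S (node S k))^T)).
Qed.

Lemma moment_of_cvg (T : Type) (F : set_system T) (FF : Filter F)
    (f : p.-tuple R -> T -> 'cV[R]_m) (l : p.-tuple R -> 'cV[R]_m) :
  (forall k, f (node S k) @ F --> l (node S k)) ->
  moment_of (f ^~ t) @[t --> F] --> moment_of l.
Proof.
move=> fl; apply: mx_cvg => i j.
rewrite mxE; under eq_fun do rewrite mxE.
apply: cvg_mxE; apply: cvg_big => // [|k _]; first exact: add_continuous.
have Lc := mx_linear_continuous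
  (f := *:%R (weight S k * joint_density S (node S k)) \o mulmxr (basis_vec S (node S k))^T).
exact: (cvg_comp _ _ (fl k) (Lc m _)).
Qed.

Lemma dual_state_linear x : linear (fun lam => dual_state S lam x).
Proof. by move=> a u v; rewrite /dual_state linearP mulmxDl scalemxAl. Qed.

Definition dual_state_lin x : {linear moments -> 'cV[R]_m} :=
  HB.pack (fun lam => dual_state S lam x)
    (GRing.isLinear.Build _ _ _ _ _ (dual_state_linear x)).

Definition dual_moment (lam : moments) : moments :=
  moment_of (fun x => u_s S (dual_state S lam x)).

Definition C1_at_nodes (lam : moments) : Prop :=
  forall k, C1_near (u_s S) (dual_state S lam (node S k)).

(** Chain-rule derivative of the moment map; its matrix is the Hessian of the dual function. *)
Definition diff_dual_moment lam h : moments :=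
  moment_of (fun x => 'd (u_s S) (dual_state S lam x) (dual_state S h x)).

Lemma dual_moment_is_diff lam :
  (forall k, differentiable (u_s S) (dual_state S lam (node S k))) ->
  is_diff lam dual_moment (diff_dual_moment lam).
Proof.
move=> us; apply: (@moment_of_is_diff _ (fun x lam => u_s S (dual_state S lam x))
  (fun x h => 'd (u_s S) (dual_state S lam x) (dual_state S h x))) => k.
have Lx := mx_linear_is_diff (dual_state_lin (node S k)) lam.
exact: (@is_diff_comp _ _ _ _ _ _ _ _ _ Lx (differentiableP (us k))).
Qed.

Lemma dual_state_near (P : 'cV[R]_m -> Prop) lam x :
  (\forall v \near dual_state S lam x, P v) ->
  \forall lam' \near lam, P (dual_state S lam' x).
Proof. exact: (mx_linear_continuous (f := dual_state_lin x)). Qed.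

Lemma C1_at_nodes_near lam : C1_at_nodes lam ->
  \forall lam' \near lam, forall k,
    differentiable (u_s S) (dual_state S lam' (node S k)).
Proof.
move=> us.
apply: (@filter_forall _ _
  (fun k lam' => differentiable (u_s S) (dual_state S lam' (node S k)))
  (nbhs lam) (nbhs_filter lam)) => k.
apply: (@dual_state_near (fun v => differentiable (u_s S) v)).
by apply: filterS (us k) => v [].
Qed.

Lemma diff_dual_moment_continuous lam h : C1_at_nodes lam ->
  {for lam, continuous (diff_dual_moment ^~ h)}.
Proof.
move=> us; apply: (@moment_of_cvg _ (nbhs lam) _
  (fun x lam => 'd (u_s S) (dual_state S lam x) (dual_state S h x))
  (fun x => 'd (u_s S) (dual_state S lam x) (dual_state S h x))) => k.
have [_ dus] := nbhs_singleton (us k).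
exact: (cvg_comp _ _ (mx_linear_continuous (f := dual_state_lin (node S k)) (x := lam)) (dus _)).
Qed.

Hypothesis entropy_convex : strictly_convex (entropy S).
Hypothesis entropy_diff : forall u, differentiable (entropy S) u.
Hypothesis entropy_grad_bij : bijective (grad (entropy S)).

Lemma u_sK : cancel (u_s S) (grad (entropy S)).
Proof.
move=> v; have [g _ gK] := entropy_grad_bij.
exact: (@xgetPex _ 0 [set u | grad (entropy S) u = v] (ex_intro _ _ (gK v))).
Qed.

(** The derivative of the Legendre transform is the pairing with [u_s]. Exchanging the quadrature
    sum with the sums over entries turns the total into the pairing of [h] with the moment
    residual. *)
Lemma dual_fun_is_diff lam uhat :
  (forall k, {for dual_state S lam (node S k), continuous (u_s S)}) ->
  is_diff lam (dual_fun S ^~ uhat)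
    (fun h => \sum_i \sum_j h i j * (dual_moment lam - uhat) i j).
Proof.
move=> us.
pose c k := weight S k * joint_density S (node S k).
have d1 : is_diff lam
   (fun lam => quad S (fun x => legendre (entropy S) (dual_state S lam x) : R^o))
   (fun h => \sum_(k < Q) c k *
      ((dual_state S h (node S k))^T *m u_s S (dual_state S lam (node S k))) 0 0).
  apply: is_diff_sum => k.
  have Lx := mx_linear_is_diff (dual_state_lin (node S k)) lam.
  have Ex := legendre_is_diff entropy_convex entropy_diff u_sK (us k).
  have LE := @is_diff_comp _ _ _ _ _ _ _ _ _ Lx Ex.
  exact: (@is_diffZ _ _ _ _ _ (c k) _ LE).
have ll : linear (fun lam : moments => \sum_i ((row i lam) *m (row i uhat)^T) 0 0 : R).
  move=> a u v; rewrite scaler_sumr -big_split/=; apply: eq_bigr => i _.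
  by rewrite linearP mulmxDl -scalemxAl mxE [X in X + _]mxE.
pose L : {linear _ -> _} := HB.pack
  (fun lam : moments => \sum_i ((row i lam) *m (row i uhat)^T) 0 0 : R)
  (GRing.isLinear.Build _ _ _ _ _ ll).
have d2 := mx_linear_is_diff L lam.
have [dd dE] := @is_diffB _ _ _ _ _ _ _ _ d1 d2.
split; first exact: dd.
transitivity (fun h => \sum_(k < Q) c k *
      ((dual_state S h (node S k))^T *m u_s S (dual_state S lam (node S k))) 0 0
   - \sum_i ((row i h) *m (row i uhat)^T) 0 0); first exact: dE.
apply/funext => h.
have -> : \sum_i (row i h *m (row i uhat)^T) 0 0 = \sum_i \sum_j h i j * uhat i j.
  by apply: eq_bigr => i _; rewrite mxE; apply: eq_bigr => j _; rewrite !mxE.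
under [in RHS]eq_bigr => i _.
  under eq_bigr => j _ do rewrite mxE [X in _ * (_ + X)]mxE mulrBr.
  rewrite sumrB; over.
rewrite sumrB; congr (_ - _).
transitivity (\sum_(k < Q) \sum_i \sum_j h i j * (c k *
   (u_s S (dual_state S lam (node S k)) j 0 * basis_vec S (node S k) i 0))).
  apply: eq_bigr => k _.
  set u := u_s S _; set phi := basis_vec S _.
  rewrite mxE mulr_sumr exchange_big/=; apply: eq_bigr => j _.
  rewrite 2!mxE mulr_suml mulr_sumr; apply: eq_bigr => i _.
  by rewrite mxE -/phi; ring.
rewrite exchange_big/=; apply: eq_bigr => i _.
rewrite exchange_big/=; apply: eq_bigr => j _.
rewrite -mulr_sumr; congr (_ * _).
rewrite mxE summxE; apply: eq_bigr => k _.
by rewrite !mxE big_ord1 !mxE (ord1 ord0).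
Qed.

Lemma dual_gradE lam uhat :
  (forall k, {for dual_state S lam (node S k), continuous (u_s S)}) ->
  dual_grad S lam uhat = dual_moment lam - uhat.
Proof.
move=> us; have [dd dE] := dual_fun_is_diff uhat us.
apply/matrixP => i j; rewrite mxE deriveE//= dE.
rewrite (bigD1 i)//= [X in _ + X]big1 => [|i' i'i]; last first.
  by apply: big1 => j' _; rewrite mxE (negPf i'i) mul0r.
rewrite addr0 (bigD1 j)//= [X in _ + X]big1 => [|j' j'j]; last first.
  by rewrite mxE (negPf j'j) andbF mul0r.
by rewrite addr0 mxE !eqxx mul1r.
Qed.

Lemma dual_gradE_near lam : C1_at_nodes lam ->
  \forall lam' \near lam, forall uhat,
    dual_grad S lam' uhat = dual_moment lam' - uhat.
Proof.
move=> /C1_at_nodes_near; apply: filterS => lam' us uhat.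
by apply: dual_gradE => k; exact: differentiable_continuous.
Qed.

Lemma dual_hessE_near lam : C1_at_nodes lam ->
  \forall lam' \near lam, forall uhat,
    dual_hess S lam' uhat = lin_mx (diff_dual_moment lam').
Proof.
move=> us; have := C1_at_nodes_near us.
(* Differentiating the gradient at [lam'] requires its formula on a whole neighbourhood of [lam'],
   not only at [lam']. *)
have := dual_gradE_near us => /nbhs_interior.
apply: filterS2 => lam' gradE us' uhat.
have d1 := dual_moment_is_diff us'.
have d2 := @is_diffB _ _ _ _ _ _ _ _ d1 (@is_diff_cst _ _ _ uhat lam').
have : is_diff lam' (dual_grad S ^~ uhat) (diff_dual_moment lam' - 0).
  apply: near_eq_is_diff d2; apply: filterS gradE => y yE.
  by rewrite yE.
move=> [_ dE]; by rewrite /dual_hess /jac dE subr0.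
Qed.

Lemma hess_continuous lam : C1_at_nodes lam ->
  {for lam, continuous (fun lam' => lin_mx (diff_dual_moment lam') : 'M[R]_(N * m))}.
Proof.
move=> us; apply: (@lin_mx_cvg _ _ (nbhs lam) _) => h.
exact: diff_dual_moment_continuous.
Qed.

Lemma diff_dual_momentP lam h :
  (forall k, differentiable (u_s S) (dual_state S lam (node S k))) ->
  mxvec (diff_dual_moment lam h) = mxvec h *m lin_mx (diff_dual_moment lam).
Proof.
move=> /dual_moment_is_diff[_ dE].
by rewrite -dE mul_vec_lin.
Qed.

(** The inverse Hessian as an operator on moment matrices, acting from the right on flattened rows
    as in [jac]. *)
Definition newton_deriv (H : 'M[R]_(N * m)) (h : moments) : moments :=
  vec_mx (mxvec h *m invmx H).

Lemma newton_deriv_linear H : linear (newton_deriv H).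
Proof. by move=> a u v; rewrite /newton_deriv !linearP/= mulmxDl -scalemxAl !linearP. Qed.

Definition newton_deriv_lin H : {linear moments -> moments} :=
  HB.pack (newton_deriv H) (GRing.isLinear.Build _ _ _ _ _ (newton_deriv_linear H)).

Lemma newton_fixed lam : C1_at_nodes lam -> newton S lam (dual_moment lam) = lam.
Proof.
move=> us; rewrite /newton (nbhs_singleton (dual_gradE_near us)) subrr.
by rewrite linear0 mul0mx linear0 subr0.
Qed.

(** The residual vanishes at [lam], so the inverse Hessian enters the product rule only through its
    continuity, and [u_s] need not be twice differentiable. *)
Lemma newton_is_diff lam uhat : C1_at_nodes lam -> dual_moment lam = uhat ->
  dual_hess S lam uhat \in unitmx ->
  is_diff (lam, uhat) (fun X => newton S X.1 X.2)
    (fun h => newton_deriv (dual_hess S lam uhat) h.2).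
Proof.
move=> us lamE; rewrite (nbhs_singleton (dual_hessE_near us)) => Hunit.
set H := lin_mx _ in Hunit *.
have fstd : is_diff (lam, uhat) (@fst moments moments) fst.
  have c := @mx_pair_linear_continuous _ _ _ _ _ _ (@fst moments moments).
  by split; [exact: linear_differentiable|exact: diff_lin].
have sndd : is_diff (lam, uhat) (@snd moments moments) snd.
  have c := @mx_pair_linear_continuous _ _ _ _ _ _ (@snd moments moments).
  by split; [exact: linear_differentiable|exact: diff_lin].
have momd : is_diff (lam, uhat) (fun X => dual_moment X.1) (fun h => diff_dual_moment lam h.1).
  have us' := nbhs_singleton (C1_at_nodes_near us).
  exact: (@is_diff_comp _ _ _ _ _ _ _ _ _ fstd (dual_moment_is_diff us')).
have gradd := @is_diffB _ _ _ _ _ _ _ _ momd sndd.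
have vecd := @is_diff_linear_comp _ _ _ _ _ (@mxvec R N m) _ _ _ gradd.
have fstc : (@fst moments moments) @ nbhs (lam, uhat) --> nbhs lam by exact: cvg_fst.
have invc : {for (lam, uhat), continuous (fun X : moments * moments =>
    invmx (lin_mx (diff_dual_moment X.1)))}.
  apply: invmx_cvg => //=.
  exact: (@cvg_comp _ _ _ (@fst moments moments)
    (fun l => lin_mx (diff_dual_moment l) : 'M[R]_(N * m)) _ _ _ fstc (hess_continuous us)).
have vec0 : (@mxvec R N m \o
    ((fun X : moments * moments => dual_moment X.1) - snd)) (lam, uhat) = 0.
  by rewrite /= !fctE lamE subrr linear0.
have stepd := @is_diff_linear_comp _ _ _ _ _ (@vec_mx R N m) _ _ _
  (is_diff_mulmx_zero vec0 vecd invc).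
have := @is_diffB _ _ _ _ _ _ _ _ fstd stepd.
set dN := (X in is_diff _ _ X) => total.
(* The derivative in direction [(h, k)] is [h - H^-1 (H h - k)], in which [h] cancels. *)
have dNE : dN = (fun h => newton_deriv H h.2).
  apply/funext => -[h k]; rewrite /dN !fctE/=.
  have us' := nbhs_singleton (C1_at_nodes_near us).
  rewrite linearB/= diff_dual_momentP// mulmxBl -/H mulmxK// linearB/= mxvecK.
  by rewrite opprB addrC subrK.
rewrite -dNE; apply: near_eq_is_diff total.
have hessN : \forall X \near (lam, uhat), forall u,
    dual_hess S X.1 u = lin_mx (diff_dual_moment X.1).
  exact: fstc _ (dual_hessE_near us).
have gradN : \forall X \near (lam, uhat), forall u,
    dual_grad S X.1 u = dual_moment X.1 - u.
  exact: fstc _ (dual_gradE_near us).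
apply: (@filterS2 _ (nbhs (lam, uhat)) _ _ _ _ _ hessN gradN) => X hessE gradE.
by rewrite /newton hessE gradE.
Qed.

End ipm_calculus.

(** * The exact dual variables as a local inverse of the moment map *)

Section dual_variables.
Context {R : realType} {m p M Q : nat} (S : ipm_data R m p M Q).
Local Notation N := 'C(M + p, p).
Local Notation moments := 'M[R]_('C(M + p, p), m).
Hypothesis entropy_convex : strictly_convex (entropy S).
Hypothesis entropy_diff : forall u, differentiable (entropy S) u.
Hypothesis entropy_grad_bij : bijective (grad (entropy S)).

Lemma dual_varP uhat : (exists lam, unique_minimizer S uhat lam) ->
  unique_minimizer S uhat (dual_var S uhat).
Proof. by case=> lam lamP; exact: (@xgetPex _ 0 _ (ex_intro _ lam lamP)). Qed.

(** A minimizer is a critical point, and the gradient of the dual function is the moment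
    residual. *)
Lemma dual_moment_dual_var uhat :
  (exists lam, unique_minimizer S uhat lam) ->
  (forall k, differentiable (u_s S) (dual_state S (dual_var S uhat) (node S k))) ->
  dual_moment S (dual_var S uhat) = uhat.
Proof.
move=> /dual_varP lamP us; set lam := dual_var S uhat in lamP us *.
have us' k : {for dual_state S lam (node S k), continuous (u_s S)}.
  exact: differentiable_continuous.
have [dd dE] := dual_fun_is_diff entropy_convex entropy_diff entropy_grad_bij uhat us'.
apply/subr0_eq; rewrite -(dual_gradE entropy_convex entropy_diff entropy_grad_bij)//.
apply/matrixP => i j; rewrite !mxE deriveE//.
apply: diff_at_min => // mu.
have [->//|mulam] := eqVneq mu lam.
exact/ltW/lamP.
Qed.

Lemma dual_moment_dual_var_near uhat :
  {for uhat, continuous (dual_var S)} ->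
  (\forall v \near uhat, exists lam, unique_minimizer S v lam) ->
  C1_at_nodes S (dual_var S uhat) ->
  \forall v \near uhat, dual_moment S (dual_var S v) = v.
Proof.
move=> gc minv us.
have usN : \forall v \near uhat, forall k,
    differentiable (u_s S) (dual_state S (dual_var S v) (node S k)).
  (* Continuity of [dual_var] keeps nearby dual variables in the region where [u_s] is
     differentiable at the node states. *)
  exact: gc _ (C1_at_nodes_near us).
apply: (@filterS2 _ (nbhs uhat) _ _ _ _ _ minv usN) => v.
exact: dual_moment_dual_var.
Qed.

Lemma dual_var_is_diff uhat lam :
  lam = dual_var S uhat ->
  {for uhat, continuous (dual_var S)} ->
  (\forall v \near uhat, exists lam, unique_minimizer S v lam) ->
  C1_at_nodes S lam ->
  dual_hess S lam uhat \in unitmx ->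
  is_diff uhat (dual_var S) (newton_deriv (dual_hess S lam uhat)).
Proof.
move=> -> gc minv us; set mu := dual_var S uhat.
rewrite (nbhs_singleton (dual_hessE_near entropy_convex entropy_diff entropy_grad_bij us)).
set H := lin_mx _ => Hunit.
have us' := nbhs_singleton (C1_at_nodes_near us).
have [momd momE] := dual_moment_is_diff us'.
apply: (@is_diff_local_inverse _ _ _ (dual_moment S) _ _ (newton_deriv_lin H)) => //.
- exact: dual_moment_dual_var_near.
- exact: mx_linear_continuous.
- move=> h; rewrite momE /newton_deriv_lin/= /newton_deriv.
  by rewrite diff_dual_momentP// mulmxK// mxvecK.
Qed.

End dual_variables.

Lemma of_rows_is_diff (R : realType) (V : normedModType R) a b n
    (F dF : V -> 'I_n -> 'M[R]_(a, b)) x :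
  (forall j, is_diff x (F ^~ j) (dF ^~ j)) ->
  is_diff x (fun y => \matrix_(j < n) mxvec (F y j)) (fun h => \matrix_(j < n) mxvec (dF h j)).
Proof.
move=> Fj; apply: mx_is_diff => j c.
have := is_diff_coord 0 c (@is_diff_linear_comp _ _ _ _ _ (@mxvec R a b) _ _ _ (Fj j)).
have cE (G : V -> 'I_n -> 'M[R]_(a, b)) :
  (fun y => (\matrix_(j < n) mxvec (G y j)) j c) = (fun y => (mxvec \o G ^~ j) y 0 c).
  by apply/funext => y; rewrite mxE.
by rewrite !cE.
Qed.

(** * The finite-volume update as a map of the cellwise dual variables *)

Section grid_iteration.
Context {R : realType} {m p M Q Nx : nat} (S : ipm_data R m p M Q).
Local Notation N := 'C(M + p, p).
Local Notation moments := 'M[R]_('C(M + p, p), m).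
Local Notation grid := 'M[R]_(Nx, 'C(M + p, p) * m).

Lemma inner_cell_linear (j : 'I_Nx) : linear (fun U : grid => inner_cell U j : moments).
Proof. by move=> a U V; rewrite /inner_cell !linearP. Qed.

Definition inner_cell_lin (j : 'I_Nx) : {linear grid -> moments} :=
  HB.pack (fun U : grid => inner_cell U j : moments)
    (GRing.isLinear.Build _ _ _ _ _ (inner_cell_linear j)).

Lemma inner_cell_of_cells (F : 'I_Nx -> moments) j : inner_cell (of_cells F) j = F j.
Proof. by rewrite /inner_cell /of_cells rowK mxvecK. Qed.

Variables (ghost_l ghost_r : moments).

Definition fv_grid (Lam : grid) : grid :=
  let lam j := cell ghost_l ghost_r Lam j in
  of_cells (fun j : 'I_Nx => fv_update S (lam j) (lam j.+1) (lam j.+2)).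

Definition cell_state (i : nat) (x : p.-tuple R) (Lam : grid) : 'cV[R]_m :=
  u_s S (dual_state S (cell ghost_l ghost_r Lam i) x).

(** Ghost cells do not depend on [Lam], so their states are constant and only inner cells need
    regularity of [u_s]. *)
Lemma cell_state_differentiable (i : nat) (k : 'I_Q) (Lam : grid) :
  (forall j : 'I_Nx, differentiable (u_s S) (dual_state S (inner_cell Lam j) (node S k))) ->
  differentiable (cell_state i (node S k)) Lam.
Proof.
move=> us; rewrite /cell_state /cell; case: i => [|i]; first exact: differentiable_cst.
case: insubP => [j _ _|_]; last exact: differentiable_cst.
have Lx := mx_linear_is_diff (dual_state_lin S (node S k) \o inner_cell_lin j) Lam.
have [d _] := @is_diff_comp _ _ _ _ _ _ _ _ _ Lx (differentiableP (us j)).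
exact: d.
Qed.

(** The index [j : 'I_Nx.+1] runs over the interfaces between cells [j] and [j.+1], ghost cells
    included; inner cell [j.+1] uses the interfaces [j] and [j.+1]. *)
Lemma fv_grid_differentiable (Lam : grid) :
  (forall (j : 'I_Nx) k, differentiable (u_s S) (dual_state S (inner_cell Lam j) (node S k))) ->
  (forall (j : 'I_Nx.+1) k, differentiable (num_flux S)
     (cell_state j (node S k) Lam, cell_state j.+1 (node S k) Lam)) ->
  differentiable fv_grid Lam.
Proof.
move=> us flux.
have sd i k : differentiable (cell_state i (node S k)) Lam.
  by apply: cell_state_differentiable => j; exact: us.
have fluxd (i : nat) k : (i < Nx.+1)%N ->
    differentiable (fun L => num_flux S
      (cell_state i (node S k) L, cell_state i.+1 (node S k) L)) Lam.
  move=> iN; apply: (@differentiable_comp _ _ _ _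
    (fun L => (cell_state i (node S k) L, cell_state i.+1 (node S k) L))).
    exact: differentiable_pair.
  exact: (flux (Ordinal iN)).
have mom (f : p.-tuple R -> grid -> 'cV[R]_m) :
    (forall k, differentiable (f (node S k)) Lam) ->
    differentiable (fun L => moment_of S (f ^~ L)) Lam.
  move=> fd.
  by have [] := @moment_of_is_diff _ _ _ _ _ S _ f (fun x => 'd (f x) Lam) _
    (fun k => differentiableP (fd k)).
have cellsd (j : 'I_Nx) : differentiable (fun L : grid => let lam j := cell ghost_l ghost_r L j in
    fv_update S (lam (nat_of_ord j)) (lam j.+1) (lam j.+2)) Lam.
  rewrite /fv_update/=; apply: differentiableB.
    by apply: (mom (cell_state j.+1)) => k.
  apply: differentiableZ; apply: differentiableB.
    apply: (mom (fun x L => num_flux S (cell_state j.+1 x L, cell_state j.+2 x L))) => k.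
    by apply: fluxd; rewrite ltnS ltn_ord.
  apply: (mom (fun x L => num_flux S (cell_state j x L, cell_state j.+1 x L))) => k.
  by apply: fluxd; rewrite ltnS ltnW// ltn_ord.
by have [] := @of_rows_is_diff _ _ _ _ _ _ _ _ (fun j => differentiableP (cellsd j)).
Qed.

End grid_iteration.

(** * Factorization of both iterations through the finite-volume update *)

Section grid_maps.
Context {R : realType} {m p M Q Nx : nat} (S : ipm_data R m p M Q).
Local Notation moments := 'M[R]_('C(M + p, p), m).
Local Notation grid := 'M[R]_(Nx, 'C(M + p, p) * m).

Definition dual_grid (U : grid) : grid :=
  of_cells (fun j => dual_var S (inner_cell U j)).

Definition newton_grid (X : grid * grid) : grid :=
  of_cells (fun j => newton S (inner_cell X.1 j) (inner_cell X.2 j)).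

Lemma cell_dual_grid (ul ur : moments) (U : grid) i :
  cell (dual_var S ul) (dual_var S ur) (dual_grid U) i = dual_var S (cell ul ur U i).
Proof.
case: i => //= i; case: insubP => //= i' _ _.
by rewrite inner_cell_of_cells.
Qed.

Lemma classical_stepE ul ur :
  classical_step S ul ur = fv_grid S (dual_var S ul) (dual_var S ur) \o dual_grid.
Proof.
apply/funext => U; apply: (congr1 (@of_cells _ _ _ _ Nx)); apply/funext => j.
by rewrite /fv_update_moments -!cell_dual_grid.
Qed.

Lemma oneshot_stepE ul ur X :
  oneshot_step S ul ur X =
  (newton_grid X, fv_grid S (dual_var S ul) (dual_var S ur) (newton_grid X)).
Proof. by []. Qed.

End grid_maps.

Theorem theorem2 (R : realType) (m p M Nx Q : nat) (S : ipm_data R m p M Q)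
    (f : 'cV[R]_m -> 'cV[R]_m)
    (consistent : forall u, num_flux S (u, u) = f u)
    (d : measure_display) (Omega : measurableType d) (P : probability Omega R)
    (xi : {RV P >-> p.-tuple R}) (Theta : set (p.-tuple R))
    (xi_Theta : forall w, Theta (xi w))
    (density1_S : forall n, is_density1 (density1 S n))
    (density_xi : has_density xi (joint_density S))
    (multi_index_bij : bijective (multi_index S))
    (orthonormal_S : orthonormal_basis S xi)
    (node_Theta : forall k, Theta (node S k))
    (entropy_convex : strictly_convex (entropy S))
    (entropy_diff : forall u, differentiable (entropy S) u)
    (entropy_grad_bij : bijective (grad (entropy S)))
    (dt_gt0 : 0 < dt S) (dx_gt0 : 0 < dx S)
    (ul ur : 'M[R]_('C(M + p, p), m))
    (ustar lamstar : 'M[R]_(Nx, 'C(M + p, p) * m))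
    (ustar_fixed : classical_step S ul ur ustar = ustar)
    (lamstarE : forall j,
       inner_cell lamstar j = dual_var S (inner_cell ustar j))
    (dual_var_ul : exists lam, unique_minimizer S ul lam)
    (dual_var_ur : exists lam, unique_minimizer S ur lam)
    (dual_var_inner : forall j, \forall v \near inner_cell ustar j,
       exists lam, unique_minimizer S v lam)
    (dual_var_cont : forall j,
       {for inner_cell ustar j, continuous (dual_var S)})
    (u_s_C1 : forall (j : 'I_Nx) (k : 'I_Q),
       C1_near (u_s S) (dual_state S (inner_cell lamstar j) (node S k)))
    (num_flux_C1 : forall (j : 'I_Nx.+1) (k : 'I_Q),
       let u (i : nat) := u_s S (dual_state S
         (cell (dual_var S ul) (dual_var S ur) lamstar i) (node S k)) in
       C1_near (num_flux S) (u j, u j.+1))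
    (hess_unit : forall j,
       dual_hess S (inner_cell lamstar j) (inner_cell ustar j) \in unitmx)
    (contractive : spectral_radius (jac (classical_step S ul ur) ustar) < 1)
    (nrm : 'M[R]_(Nx, 'C(M + p, p) * m) * 'M[R]_(Nx, 'C(M + p, p) * m) -> R)
    (nrm_norm : is_norm nrm) :
  exists delta : R, 0 < delta /\
    forall X0 : 'M[R]_(Nx, 'C(M + p, p) * m) * 'M[R]_(Nx, 'C(M + p, p) * m),
      nrm (X0 - (lamstar, ustar)) < delta ->
      nrm (iter n (oneshot_step S ul ur) X0 - (lamstar, ustar)) @[n --> \oo]
        --> (0 : R).
Proof.
set N := 'C(M + p, p).
pose grid := 'M[R]_(Nx, N * m).
have us j : C1_at_nodes S (inner_cell lamstar j) by exact: u_s_C1.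
have minj j : exists lam, unique_minimizer S (inner_cell ustar j) lam.
  exact: nbhs_singleton (dual_var_inner j).
have dmE j : dual_moment S (inner_cell lamstar j) = inner_cell ustar j.
  rewrite lamstarE; apply: dual_moment_dual_var => // k; rewrite -lamstarE.
  exact: (nbhs_singleton (C1_at_nodes_near (us j))).
pose G := dual_grid S (Nx := Nx).
pose C := fv_grid S (Nx := Nx) (dual_var S ul) (dual_var S ur).
pose Nw := newton_grid S (Nx := Nx).
pose H j := dual_hess S (inner_cell lamstar j) (inner_cell ustar j).
(* The cellwise inverse Hessian: the derivative of [G] at [ustar], and that of [Nw] at the fixed
   point in its second argument. *)
pose E (k : grid) : grid := of_cells (fun j => newton_deriv (H j) (inner_cell k j)).
have El : linear E.
  move=> a u v; apply/row_matrixP => j; rewrite linearP/= !rowK.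
  have -> : inner_cell (a *: u + v) j = a *: inner_cell u j + inner_cell v j.
    exact: inner_cell_linear.
  by rewrite (newton_deriv_linear (H j)) linearP.
pose EL : {linear grid -> grid} := HB.pack E (GRing.isLinear.Build _ _ _ _ _ El).
have Gstar : G ustar = lamstar.
  by apply/row_matrixP => j; rewrite rowK -lamstarE vec_mxK.
have Nwstar : Nw (lamstar, ustar) = lamstar.
  by apply/row_matrixP => j; rewrite rowK/= -dmE newton_fixed ?vec_mxK.
have classicalE : classical_step S ul ur = C \o G by exact: classical_stepE.
have Cd : differentiable C lamstar.
  apply: fv_grid_differentiable => j k.
    exact: (nbhs_singleton (C1_at_nodes_near (us j))).
  by have [] := nbhs_singleton (num_flux_C1 j k).
have Gd : is_diff ustar G E.
  apply: (@of_rows_is_diff _ _ _ _ _ (fun U j => dual_var S (inner_cell U j))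
    (fun k j => newton_deriv (H j) (inner_cell k j))) => j.
  have Ld := mx_linear_is_diff (inner_cell_lin j) ustar.
  have Dd := dual_var_is_diff entropy_convex entropy_diff entropy_grad_bij
    (lamstarE j) (dual_var_cont j) (dual_var_inner j) (us j) (hess_unit j).
  exact: (@is_diff_comp _ _ _ _ _ _ _ _ _ Ld Dd).
have Nwd : is_diff (lamstar, ustar) Nw (fun h => E h.2).
  apply: (@of_rows_is_diff _ _ _ _ _
    (fun X j => newton S (inner_cell X.1 j) (inner_cell X.2 j))
    (fun h j => newton_deriv (H j) (inner_cell h.2 j))) => j.
  have Lf : is_diff (lamstar, ustar) (fun X : grid * grid => inner_cell X.1 j)
      (fun X => inner_cell X.1 j).
    have c := mx_pair_linear_continuous (f := inner_cell_lin j \o @fst grid grid).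
    by split; [exact: linear_differentiable c|exact: diff_lin c].
  have Ls : is_diff (lamstar, ustar) (fun X : grid * grid => inner_cell X.2 j)
      (fun X => inner_cell X.2 j).
    have c := mx_pair_linear_continuous (f := inner_cell_lin j \o @snd grid grid).
    by split; [exact: linear_differentiable c|exact: diff_lin c].
  have Nd := newton_is_diff entropy_convex entropy_diff entropy_grad_bij
    (us j) (dmE j) (hess_unit j).
  exact: (@is_diff_comp _ _ _ _ _ _ _ _ _ (is_diff_pair Lf Ls) Nd).
have CGd : is_diff (G ustar) C ('d C lamstar).
  by rewrite Gstar; exact: differentiableP.
have CNd : is_diff (Nw (lamstar, ustar)) C ('d C lamstar).
  by rewrite Nwstar; exact: differentiableP.
have classicald : is_diff ustar (classical_step S ul ur) ('d C lamstar \o EL).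
  by rewrite classicalE; exact: (@is_diff_comp _ _ _ _ _ _ _ _ _ Gd CGd).
have oneshotd : is_diff (lamstar, ustar) (oneshot_step S ul ur)
    (fun h => (E h.2, 'd C lamstar (E h.2))).
  exact: (is_diff_pair Nwd (@is_diff_comp _ _ _ _ _ _ _ _ _ Nwd CNd)).
have fixed : oneshot_step S ul ur (lamstar, ustar) = (lamstar, ustar).
  rewrite oneshot_stepE -/Nw Nwstar; congr pair.
  by rewrite -[RHS]ustar_fixed classicalE /= Gstar.
(* The hypothesis now bounds the spectral radius of ['d C lamstar \o EL], the operator that governs
   the powers of the One-Shot derivative. *)
rewrite (is_diff_jac classicald) in contractive.
have [n n0 contr] := iter_block_contraction (E := EL) contractive.
have near_cvg := iter_cvg_fixed_point n0 fixed oneshotd contr.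
have [K K0 KP] := norm_equiv_mx_pair nrm_norm.
have [_/posnumP[e] ball_cvg] := (nbhs_ballP _ _).1 near_cvg.
(* Since [|x| <= K * nrm x], this [nrm]-ball lies inside the ball of attraction of radius [e] in the
   ambient norm. *)
exists (e%:num / K); split=> [|X0 X0e]; first by rewrite divr_gt0.
have /ball_cvg X0cvg : ball (lamstar, ustar) e%:num X0.
  rewrite -ball_normE/= distrC; apply: le_lt_trans (KP _).2 _.
  by rewrite mulrC -ltr_pdivlMr.
have nrm_ge0 x : 0 <= nrm x.
  by rewrite -(pmulr_rge0 _ K0) (le_trans _ (KP x).2).
by apply: (@dominated_norm_cvg0 _ _ _ K) X0cvg => x; rewrite nrm_ge0 (KP x).1.
Qed.
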